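(* Let $u,v:\,]0,1[^2\to\,]0,\infty[$ be continuous functions such that for all $(p,q)\in\,]0,1[^2$ and all integers $n\ge 1$, $$\partial_p\theta_n(p,q)\le u(p,q)\,\partial_q\theta_n(p,q)\qquad\text{and}\qquad \partial_q\theta_n(p,q)\le v(p,q)\,\partial_p\theta_n(p,q).$$ Let $\gamma=(\gamma_p,\gamma_q):[0,1]\to[0,1]^2$ be a continuous path such that $\gamma$ is of class $C^1$ on $]0,1[$ and $\gamma(]0,1[)\subset\,]0,1[^2$. Assume that for all $t\in\,]0,1[$ at least one of the following two inequalities holds: $$\text{(i)}\quad \gamma_q'(t)\ge\max\{0,\,-u(\gamma(t))\,\gamma_p'(t)\},\qquad\qquad \text{(ii)}\quad \gamma_p'(t)\ge\max\{0,\,-v(\gamma(t))\,\gamma_q'(t)\}.$$ Then for all integers $n\ge0$ the function $\theta_n\circ\gamma$ is nondecreasing on $[0,1]$. Moreover, if there exists $t_c\in\,]0,1[$ such that $\theta(\gamma(t))=0$ for all $0\le t<t_c$ and $\theta(\gamma(t))>0$ for all $t_c<t\le1$, and if at $t=t_c$ at least one of the inequalities (i), (ii) holds strictly (without equality), then: (a) for every $0\le t<t_c$ there exists $c_t>0$ such that for all $n$ large enough, $\theta_n(\gamma(t))\le\exp(-c_t n)$; (b) there exist $c>0$ and $\delta>0$ such that $\theta(\gamma(t))\ge c\,(t-t_c)$ for all $t_c\le t\le t_c+\delta$.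
   Context: Combined site and bond Bernoulli percolation on $\mathbb Z^d$ ($d$ a positive integer), with site parameter $q\in[0,1]$ and bond parameter $p\in[0,1]$, is represented as site percolation on the following graph $G=(V,E)$: $V$ is the set of $x\in\mathbb Z^d$ having at most one odd coordinate, and edges join vertices at $\ell^1$-distance $1$. Let $V_0=2\mathbb Z^d$ (playing the role of the original sites) and $V_1=V\setminus V_0$ (playing the role of the original bonds). All vertices of $V$ are independently occupied (state $\omega(x)=1$) or empty (state $0$), with probability $q$ of being occupied for vertices in $V_0$ and probability $p$ for vertices in $V_1$. For an integer $n\ge 0$, $L_n=\{x\in V:\|x\|_\infty\le n\}$ and $\partial L_n=\{x\in V:\|x\|_\infty=n\}$. For $x\in V$ and $W\subset V$, $x\leftrightarrow W$ means that there is a path in $G$ from $x$ to a vertex of $W$ all of whose vertices (endpoints included) are occupied, with the convention that $x\leftrightarrow x$ always holds (so $x\leftrightarrow W$ always holds if $x\in W$). $0\leftrightarrow\infty$ means that $0$ lies in an infinite connected component of occupied vertices. $\theta_n(p,q)=\mathbb P(0\leftrightarrow\partial L_n)$ (so $\theta_0=1$) and $\theta(p,q)=\mathbb P(0\leftrightarrow\infty)$. Functions $u,v$ as in the claim exist; for example $u(p,q)=2d\,q/p$ and $v(p,q)=\frac{2(2d-1)p}{q(1-p)^{2d-1}}$ are admissible. Notation: $]a,b[$ is the open interval. *)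

(* Defs.v *)
From HB Require Import structures.
From mathcomp Require Import all_boot all_order all_algebra.
From mathcomp Require Import all_classical all_reals all_analysis.

Set Implicit Arguments.
Unset Strict Implicit.
Unset Printing Implicit Defensive.

Import Order.TTheory GRing.Theory Num.Theory.
Import numFieldNormedType.Exports.

Local Open Scope classical_set_scope.
Local Open Scope ring_scope.

Definition num_odd (d : nat) (x : 'rV[int]_d) : nat :=
  #|[pred i : 'I_d | odd `|x ord0 i|%N]|.

Definition vertex (d : nat) := {x : 'rV[int]_d | (num_odd x <= 1)%N}.

(* V_0 = 2 Z^d, the original sites; its complement V_1 consists of the midpoints
   of the original bonds. *)
Definition is_site (d : nat) (x : vertex d) : bool := num_odd (val x) == 0%N.

Lemma origin_subproof (d : nat) : (num_odd (0 : 'rV[int]_d) <= 1)%N.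
Proof. by rewrite /num_odd eq_card0 // => i; rewrite !inE mxE. Qed.

Definition origin (d : nat) : vertex d := exist _ 0 (origin_subproof d).

Definition l1dist (d : nat) (x y : 'rV[int]_d) : nat :=
  (\sum_(i < d) `|(x ord0 i - y ord0 i)%R|)%N.

Definition linf_norm (d : nat) (x : 'rV[int]_d) : nat :=
  (\max_(i < d) `|x ord0 i|)%N.

Definition adj (d : nat) : rel (vertex d) :=
  fun x y => l1dist (val x) (val y) == 1%N.

Definition box_boundary (d n : nat) : set (vertex d) :=
  [set x | linf_norm (val x) = n].

(* In a configuration [w], a path of occupied vertices from [x] to [y], both
   endpoints included: it forces [w x] even when [x = y]. *)
Definition open_path (d : nat) (w : vertex d -> bool) (x y : vertex d) : Prop :=
  exists s : seq (vertex d), [/\ path (@adj d) x s, last x s = y & all w (x :: s)].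

(* [x <-> W]; the first disjunct is the convention that [x <-> x] always holds,
   whatever the state of [x]. *)
Definition connected_to (d : nat) (w : vertex d -> bool) (x : vertex d)
    (W : set (vertex d)) : Prop :=
  W x \/ exists2 y, W y & open_path w x y.

(* Empty if [x] is not occupied. *)
Definition cluster_of (d : nat) (w : vertex d -> bool) (x : vertex d) :
    set (vertex d) :=
  [set y | open_path w x y].

Definition percolates (d : nat) (w : vertex d -> bool) : Prop :=
  infinite_set (cluster_of w (origin d)).

(* Under [P], the occupation variables [omega x] are mutually independent
   (product rule over every finite subfamily), with parameter [q] on sites and
   [p] on bonds. *)
Definition site_bond_percolation (R : realType) (dsp : measure_display)
    (Omega : measurableType dsp) (d : nat) (omega : vertex d -> Omega -> bool)
    (P : probability Omega R) (p q : R) : Prop :=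
  [/\ forall x, measurable_fun setT (omega x),
      forall x, P [set o | omega x o] = (if is_site x then q else p)%:E &
      forall (A : seq (vertex d)) (B : vertex d -> set bool), uniq A ->
        P (\bigcap_(x in [set` A]) (omega x @^-1` B x)) =
        (\prod_(x <- A) P (omega x @^-1` B x))%E].

(* [P p q] is the law with bond parameter [p] and site parameter [q]. *)
Definition theta_n (R : realType) (dsp : measure_display)
    (Omega : measurableType dsp) (d : nat) (omega : vertex d -> Omega -> bool)
    (P : R -> R -> probability Omega R) (n : nat) (p q : R) : R :=
  fine (P p q
    [set o | connected_to (omega ^~ o) (origin d) (@box_boundary d n)]).

Definition theta (R : realType) (dsp : measure_display)
    (Omega : measurableType dsp) (d : nat) (omega : vertex d -> Omega -> bool)
    (P : R -> R -> probability Omega R) (p q : R) : R :=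
  fine (P p q [set o | percolates (omega ^~ o)]).

(* Main.v *)
Require Import Defs.
From HB Require Import structures.
From mathcomp Require Import all_boot all_order all_algebra.
From mathcomp Require Import all_classical all_reals all_analysis.
From mathcomp Require Import finmap zify ring lra.
Import Order.TTheory GRing.Theory Num.Theory.
Import numFieldNormedType.Exports.

(** The argument is that of Duminil-Copin and Tassion. For a finite set [S] of
    vertices containing the origin, let [phi S] be the expected number of outer
    neighbours of [S] that are adjacent to the cluster of the origin inside [S].

    If [phi S] is small for some [S], then conditioning on the cluster of the
    origin inside [S] gives [theta_N <= 2^-1 * theta_(N - m)], hence exponential
    decay. When the exit vertex is a bond it is replaced by a neighbouring site,
    so that only translations by even vectors, which preserve the law, occur.

    If [phi S] is bounded below for all [S], apply this to the random set of
    vertices that would not be connected to the boundary of the box even if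
    occupied. The event that it equals [S] is determined by the configuration
    outside [S], hence independent of the cluster of the origin inside [S]; and an
    outer neighbour of [S] adjacent to that cluster is then empty and pivotal. By
    Russo's formula the sum of the two partial derivatives of [theta_n] is bounded
    below uniformly in [n].

    Since [theta_n] is nondecreasing along the curve, the times at which it decays
    exponentially in [n] form an initial segment. Past this segment and close to
    [tc] the slope of [theta_n] along the curve is bounded below uniformly in [n],
    so [theta] is positive there; hence the segment extends up to [tc], and beyond
    [tc] the same bound gives linear growth. *)

Set Implicit Arguments.
Unset Strict Implicit.
Unset Printing Implicit Defensive.
Local Open Scope ring_scope.

(** * Product measures on finite sets and Russo's formula *)

Section ProductMeasure.
Import boot.fintype boot.finset.
Variables (R : realFieldType) (T : finType).
Implicit Types (r : T -> R) (A D : {set T}) (E F : pred {set T}).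

Definition weight r A : R := \prod_x (if x \in A then r x else 1 - r x).

Definition prob r E : R := \sum_(A | E A) weight r A.

Lemma weight_ge0 r A : (forall x, 0 <= r x <= 1) -> 0 <= weight r A.
Proof.
move=> r01; apply: prodr_ge0 => x _.
by case: ifP => _; have /andP[? ?] := r01 x; rewrite ?subr_ge0.
Qed.

Lemma prob_predT r : prob r predT = 1.
Proof.
rewrite /prob /weight -bigA_distr big1 // => x _.
by rewrite /= addrCA subrr addr0.
Qed.

Lemma eq_prob r E F : E =1 F -> prob r E = prob r F.
Proof. by move=> EF; apply: eq_bigl. Qed.

Lemma prob_ge0 r E : (forall x, 0 <= r x <= 1) -> 0 <= prob r E.
Proof. by move=> r01; apply: sumr_ge0 => A _; exact: weight_ge0. Qed.

Lemma le_prob r E F : (forall x, 0 <= r x <= 1) -> subpred E F ->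
  prob r E <= prob r F.
Proof.
move=> r01 EF; rewrite /prob [leRHS](bigID E) /=.
rewrite (eq_bigl E) ?lerDl; first by apply: sumr_ge0 => A _; exact: weight_ge0.
by move=> A; case EA: (E A); rewrite ?andbF// andbT EF.
Qed.

Lemma prob_partition (I : finType) (f : {set T} -> I) r E :
  prob r E = \sum_i prob r (fun A => E A && (f A == i)).
Proof. by rewrite /prob (partition_big f xpredT). Qed.

Lemma prob_union (I : finType) (Q : pred I) (F : I -> pred {set T}) r E :
  (forall x, 0 <= r x <= 1) ->
  (forall A, E A -> exists2 i, Q i & F i A) ->
  prob r E <= \sum_(i | Q i) prob r (F i).
Proof.
move=> r01 EF; rewrite /prob.
rewrite [leRHS](eq_bigr (fun i => \sum_A if F i A then weight r A else 0)); last first.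
  by move=> i _; rewrite [LHS]big_mkcond.
rewrite [leRHS]exchange_big /= big_mkcond; apply: ler_sum => A _.
have ge0 i : 0 <= (if F i A then weight r A else 0).
  by case: ifP => // _; exact: weight_ge0.
case: ifPn => [/EF[i Qi FiA]|_]; last by apply: sumr_ge0.
by rewrite (bigD1 i)//= FiA lerDl; apply: sumr_ge0.
Qed.

(* Exchanging the parts outside [D] of two independent copies of the
   configuration preserves their joint law. *)
Lemma prob_indep r D E F :
  (forall A, E A = E (A :&: D)) -> (forall A, F A = F (A :\: D)) ->
  prob r (predI E F) = prob r E * prob r F.
Proof.
move=> ED FD.
pose sw (u : {set T} * {set T}) :=
  ((u.1 :&: D) :|: (u.2 :\: D), (u.2 :&: D) :|: (u.1 :\: D)).
have swK : involutive sw.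
  by move=> [A B]; congr (_, _); apply/setP => x; rewrite !inE /=;
    case: (x \in D); case: (x \in A); case: (x \in B).
rewrite -[LHS]mulr1 -(prob_predT r) /prob 2!big_distrlr /= 2!pair_big /=.
rewrite [LHS](reindex_inj (inv_inj swK)) /=.
apply: eq_big => [[A B]|[A B] _] /=.
- rewrite andbT ED FD (ED A) (FD B).
  by congr (E _ && F _); apply/setP => x; rewrite !inE;
    case: (x \in D); rewrite ?andbF ?andbT ?orbF.
- rewrite /weight -!big_split /=; apply: eq_bigr => x _; rewrite !inE.
  case: (x \in D); rewrite ?andbF ?andbT ?orbF //=.
  by rewrite mulrC.
Qed.

Lemma sum_set_pair (y : T) (g : {set T} -> R) :
  \sum_A g A = \sum_(A : {set T} | y \notin A) (g A + g (y |: A)).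
Proof.
rewrite (bigID (fun A : {set T} => y \notin A)) /= big_split /=; congr (_ + _).
rewrite (reindex_onto (fun A => y |: A) (fun A => A :\ y)) /=; last first.
  by move=> A; rewrite negbK => yA; rewrite setD1K.
apply: eq_bigl => A; rewrite negbK setU11 /=.
by apply/eqP/idP => [<-|yA]; [rewrite setD11|rewrite setU1K].
Qed.

(** Cross-multiplied, so that [r y = 1] is allowed. *)
Lemma weightU1 r A (y : T) : y \notin A ->
  (1 - r y) * weight r (y |: A) = r y * weight r A.
Proof.
move=> yA; rewrite /weight (bigD1 y)//= [in RHS](bigD1 y)//= setU11 (negbTE yA).
rewrite mulrCA; congr (_ * (_ * _)); apply: eq_bigr => x /negbTE xy.
by rewrite !inE xy.
Qed.

Lemma prob_notin r (y : T) : prob r (fun A => y \notin A) = 1 - r y.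
Proof.
have w1 A : y \notin A -> (1 - r y) * (weight r A + weight r (y |: A)) = weight r A.
  by move=> yA; rewrite mulrDr weightU1// -mulrDl subrK mul1r.
have p1 := prob_predT r; rewrite /prob (sum_set_pair y) in p1.
rewrite -[RHS]mulr1 -[X in _ = _ * X]p1.
by apply/esym; rewrite mulr_sumr; apply: eq_bigr => A yA; exact: w1.
Qed.

(* The coefficient of the derivative of [r y] in the derivative of [prob r E],
   obtained by logarithmic differentiation of [weight]. *)
Definition influence r E y : R :=
  \sum_(A | E A) weight r A * (if y \in A then (r y)^-1 else - (1 - r y)^-1).

(** Pair [A] with [y |: A]. If both satisfy [E], their terms in [influence] cancel; if only the
    larger one does, [y] is pivotal and the term is the weight of [A] divided by [1 - r y], which is
    at least that weight. *)
Lemma prob_pivotal_le r E y :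
  (forall x, 0 <= r x <= 1) -> 0 < r y < 1 ->
  (forall A A', A \subset A' -> E A -> E A') ->
  prob r (fun A => [&& y \notin A, ~~ E A & E (y |: A)]) <= influence r E y.
Proof.
move=> r01 /andP[r0 r1] Einc.
have s0 : 0 < 1 - r y by rewrite subr_gt0.
rewrite /influence big_mkcond (sum_set_pair y) /prob.
rewrite (eq_bigl (fun A => (y \notin A) && (~~ E A && E (y |: A)))) //.
rewrite big_mkcondr; apply: ler_sum => A yA.
rewrite setU11 (negbTE yA).
set w := weight r A.
have -> : weight r (y |: A) = w * r y / (1 - r y).
  apply: (mulfI (lt0r_neq0 s0)); rewrite weightU1// mulrCA mulfV ?gt_eqF//.
  by rewrite mulr1 mulrC.
have w0 : 0 <= w by exact: weight_ge0.
case EA: (E A) => /=.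
  rewrite (Einc _ _ (subsetU1 y A) EA).
  suff -> : w * - (1 - r y)^-1 + w * r y / (1 - r y) / r y = 0 by [].
  by field; rewrite !gt_eqF.
rewrite add0r; case: ifP => // _.
rewrite mulrAC mulfK ?gt_eqF// ler_peMr//.
by rewrite invf_ge1// gerBl ltW.
Qed.

Lemma influence_ge0 r E y :
  (forall x, 0 <= r x <= 1) -> 0 < r y < 1 ->
  (forall A A', A \subset A' -> E A -> E A') -> 0 <= influence r E y.
Proof.
by move=> r01 ry Einc; apply: le_trans (prob_pivotal_le r01 ry Einc);
  exact: prob_ge0.
Qed.

End ProductMeasure.

(** * Clusters in a finite graph *)

Section Clusters.
Import boot.fintype boot.finset.
Variables (T : finType) (e : rel T).
Implicit Types (A B C D S : {set T}) (x y z : T).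

Definition occupied_rel A : rel T := [rel x y | [&& e x y, x \in A & y \in A]].

(** Membership of [x] excludes the empty path from an unoccupied vertex, as [connect] is
    reflexive. *)
Definition conn A x y : bool := (x \in A) && connect (occupied_rel A) x y.

Definition reaches A B x : bool := [exists b in B, conn A x b].

Lemma conn_refl A x : x \in A -> conn A x x.
Proof. by rewrite /conn connect0 andbT. Qed.

Lemma conn_memr A x y : conn A x y -> y \in A.
Proof.
case/andP=> xA /connectP[s]; elim/last_ind: s y => [|s z _] y /=; first by move=> _ ->.
by rewrite rcons_path last_rcons => /andP[_ /and3P[_ _ zA]] ->.
Qed.

Lemma conn_step A x z y : x \in A -> e x z -> conn A z y -> conn A x y.
Proof.
move=> xA exz /andP[zA zy]; rewrite /conn xA; apply: connect_trans zy.
by apply: connect1; rewrite /occupied_rel /occupied_rel /= exz xA zA.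
Qed.

Lemma conn_stepr A x y z : conn A x y -> e y z -> z \in A -> conn A x z.
Proof.
move=> xy eyz zA; have yA := conn_memr xy; case/andP: xy => xA xy.
rewrite /conn xA; apply: connect_trans xy _; apply: connect1.
by rewrite /occupied_rel /= eyz yA zA.
Qed.

Lemma conn_ind A y (Q : T -> Prop) :
  (y \in A -> Q y) ->
  (forall x z, x \in A -> e x z -> conn A z y -> Q z -> Q x) ->
  forall x, conn A x y -> Q x.
Proof.
move=> Qy Qstep x xy; have yA := conn_memr xy.
case/andP: xy => xA /connectP[s].
elim: s x xA => [|z s IH] x xA /=; first by move=> _ <-; exact: Qy.
move=> /andP[/and3P[exz _ zA] zs] yE.
apply: (Qstep x z) => //; last exact: IH.
by rewrite /conn zA; apply/connectP; exists s.
Qed.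

Lemma conn_indr A x (Q : T -> Prop) :
  (x \in A -> Q x) ->
  (forall z y, conn A x z -> e z y -> y \in A -> Q z -> Q y) ->
  forall y, conn A x y -> Q y.
Proof.
move=> Qx Qstep y /andP[xA /connectP[s]].
elim/last_ind: s y => [|s z IH] y /=; first by move=> _ ->; exact: Qx.
rewrite rcons_path last_rcons => /andP[ps /and3P[ez _ zA]] ->.
apply: (Qstep (last x s)) => //; last exact: IH.
by rewrite /conn xA; apply/connectP; exists s.
Qed.

Lemma conn_sub A A' x y : A \subset A' -> conn A x y -> conn A' x y.
Proof.
move=> /subsetP AA'; move: x; apply: conn_ind => [/AA' /conn_refl //|].
by move=> x z /AA' xA exz _; exact: conn_step.
Qed.

Lemma reaches_sub A A' B x : A \subset A' -> reaches A B x -> reaches A' B x.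
Proof.
move=> AA' /existsP[b /andP[bB xb]]; apply/existsP; exists b.
by rewrite bB (conn_sub AA').
Qed.

Lemma reaches_refl A B x : x \in A -> x \in B -> reaches A B x.
Proof. by move=> xA xB; apply/existsP; exists x; rewrite xB conn_refl. Qed.

Lemma reaches_step A B x z : x \in A -> e x z -> reaches A B z -> reaches A B x.
Proof.
move=> xA exz /existsP[b /andP[bB zb]]; apply/existsP; exists b.
by rewrite bB (conn_step xA exz).
Qed.

Lemma reaches_conn A B x z : conn A x z -> reaches A B z -> reaches A B x.
Proof.
move=> xz zB; move: x xz; apply: conn_ind => // x z' xA exz' _.
exact: reaches_step.
Qed.

Lemma reaches_ind A B (Q : T -> Prop) :
  (forall y, y \in A -> y \in B -> Q y) ->
  (forall x z, x \in A -> e x z -> reaches A B z -> Q z -> Q x) ->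
  forall x, reaches A B x -> Q x.
Proof.
move=> Qy Qs x /existsP[b /andP[bB]]; move: x; apply: conn_ind => [bA|x z xA exz zb].
  exact: Qy.
by apply: Qs => //; apply/existsP; exists b; rewrite bB.
Qed.

Lemma reaches_next A B x : reaches A B x -> x \notin B ->
  exists2 z, e x z & reaches A B z.
Proof.
by move: x; apply: reaches_ind => [y _ -> //|x z _ exz zB _ _]; exists z.
Qed.

(* The state of [x] itself is ignored: [x] lies in [wired A B] if and only if
   occupying [x] would connect it to [B]. *)
Definition wired A B : {set T} :=
  [set x | (x \in B) || [exists y, e x y && reaches A B y]].

Lemma wiredP A B x :
  reflect (x \in B \/ exists2 y, e x y & reaches A B y) (x \in wired A B).
Proof.
rewrite inE; apply: (iffP orP) => -[]; try by left.
  by case/existsP=> y /andP[exy yB]; right; exists y.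
by case=> y exy yB; right; apply/existsP; exists y; rewrite exy.
Qed.

Lemma reaches_wired A B x : reaches A B x -> x \in wired A B.
Proof.
move=> xB; apply/wiredP; have [|xNB] := boolP (x \in B); first by left.
by right; exact: reaches_next.
Qed.

Lemma wired_reaches A B x : x \in A -> x \in wired A B -> reaches A B x.
Proof.
move=> xA /wiredP[|[y]]; first exact: reaches_refl.
exact: reaches_step.
Qed.

(** Follow a path in [A] backwards from [B]: each vertex met is wired in [A'], so by hypothesis it
    lies in [A']. *)
Lemma reaches_wired_sub A A' B : A' \subset A ->
  (forall x, x \in A -> x \in wired A' B -> x \in A') ->
  wired A B = wired A' B.
Proof.
move=> A'A AA'; have RR : reaches A B =1 reaches A' B.
  move=> x; apply/idP/idP; last exact: reaches_sub.
  move: x; apply: reaches_ind => [y yA yB|x z xA exz _ zB].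
    by apply: reaches_refl => //; apply: AA' => //; apply/wiredP; left.
  by apply: (reaches_step _ exz zB); apply: AA' => //; apply/wiredP; right; exists z.
apply/setP => x; rewrite !inE; congr (_ || _).
by apply: eq_existsb => y; rewrite RR.
Qed.

(* An occupied path to [B] runs through [wired A B] only. *)
Lemma wired_local A B S :
  (wired A B == ~: S) = (wired (A :\: S) B == ~: S).
Proof.
apply/eqP/eqP => WS.
- rewrite -WS; apply/esym/reaches_wired_sub; first exact: subsetDl.
  move=> x xA xW.
  suff : x \in wired A B by rewrite WS !inE xA => ->.
  move: xW => /wiredP[xB|[y exy yB]]; apply/wiredP; [by left|right].
  by exists y => //; apply: reaches_sub yB; exact: subsetDl.
- rewrite -WS; apply: reaches_wired_sub; first exact: subsetDl.
  by move=> x xA; rewrite WS !inE xA andbT.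
Qed.

(** An occupied [y] would make its neighbour [x] wired, contradicting [x \in S], so [y] is empty.
    Being wired itself, [y] joins the cluster of [o] to [B] as soon as it is occupied. *)
Lemma pivotal_of_wired A B S o x y :
  wired A B = ~: S -> o \in S -> conn (A :&: S) o x -> e x y -> y \notin S ->
  [&& y \notin A, ~~ reaches A B o & reaches (y |: A) B o].
Proof.
move=> WS oS ox exy yNS.
have yW : y \in wired A B by rewrite WS inE.
have xS : x \in S by have := conn_memr ox; rewrite inE => /andP[].
have xNW : x \notin wired A B by rewrite WS inE negbK.
apply/and3P; split.
- apply: contra xNW => yA; apply/wiredP; right; exists y => //.
  exact: wired_reaches.
- by apply/negP => /reaches_wired; rewrite WS inE oS.
- apply: (@reaches_conn _ _ _ x).
    by apply: conn_sub ox; apply: subset_trans (subsetIl _ _) (subsetU1 _ _).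
  have xA : x \in y |: A by have := conn_memr ox; rewrite !inE => /andP[->]; rewrite orbT.
  apply: reaches_step exy _ => //.
  case/wiredP: yW => [yB|[z eyz zB]]; first by apply: reaches_refl; rewrite ?setU11.
  by apply: reaches_step eyz _; rewrite ?setU11//; apply: reaches_sub zB; exact: subsetU1.
Qed.

(** Covers the case where the set of non-wired vertices misses [o], so that it contains no cluster
    of [o] to leave: [o] is then itself the pivotal vertex. *)
Lemma pivotal_source A B o : o \notin A -> o \in wired A B ->
  [&& o \notin A, ~~ reaches A B o & reaches (o |: A) B o].
Proof.
move=> oA oW; rewrite oA /=; apply/andP; split.
  by apply: contra oA => /existsP[b /andP[_ /andP[]]].
case/wiredP: oW => [oB|[z eoz zB]]; first by apply: reaches_refl; rewrite ?setU11.
by apply: reaches_step eoz _; rewrite ?setU11//; apply: reaches_sub zB; exact: subsetU1.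
Qed.

Definition reaches_nbr A o y : bool := [exists x, e x y && conn A o x].

Definition cluster A o : {set T} := [set x | conn A o x].

(** What an exploration of the cluster inside [S] examines when it ends with [C]. *)
Definition shell S C : {set T} :=
  S :&: (C :|: [set y | [exists x in C, e x y]]).

(** Connections inside the cluster stay in [C], and a first step out of [C] within [S] would be seen
    in the shell. This locality is the independence input of [prob_reaches_le]. *)
Lemma cluster_local A S C o : o \in C ->
  (cluster (A :&: S) o == C) = (cluster (A :&: shell S C :&: S) o == C).
Proof.
move=> oC.
have sub : A :&: shell S C :&: S \subset A :&: S by apply/setSI/subsetIl.
have memC Z y : y \in cluster Z o -> conn Z o y by rewrite inE.
apply/eqP/eqP => CE; apply/eqP; rewrite eqEsubset; apply/andP; split.
- by apply/subsetP => x; rewrite inE => ox; rewrite -CE inE; exact: conn_sub ox.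
- have inC z : conn (A :&: S) o z -> z \in A :&: shell S C :&: S.
    move=> oz; have zC : z \in C by rewrite -CE inE.
    by have := conn_memr oz; rewrite /shell !inE zC => /andP[-> ->].
  apply/subsetP => x; rewrite -{1}CE !inE; move: x; apply: conn_indr => [oAS|z y oz ezy yAS oz'].
    by apply: conn_refl; apply: inC; exact: conn_refl.
  by apply: (conn_stepr oz' ezy); apply: inC; exact: conn_stepr oz ezy yAS.
- have o_in : o \in A :&: shell S C :&: S.
    by have /memC/andP[] : o \in cluster (A :&: shell S C :&: S) o by rewrite CE.
  suff sub' x : conn (A :&: S) o x -> conn (A :&: shell S C :&: S) o x.
    by apply/subsetP => x; rewrite inE => /sub' ox; rewrite -CE inE.
  move: x; apply: conn_indr => [_|z y _ ezy yAS oz]; first exact: conn_refl.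
  apply: (conn_stepr oz ezy); have zC : z \in C by rewrite -CE inE.
  move: yAS; rewrite /shell !inE => /andP[-> ->] /=.
  by rewrite andbT; apply/orP; right; apply/existsP; exists z; rewrite zC.
- by rewrite -{1}CE; apply/subsetP => x; rewrite !inE; exact: conn_sub.
Qed.

(** Cut the path at its last visit to [C]. The induction runs backwards from [B], its first
    alternative being that the current vertex reaches [B] off [C]. *)
Lemma last_exit A B C o : reaches A B o -> o \in C -> [disjoint B & C] ->
  exists x y, [/\ x \in C, e x y & reaches (A :\: C) B y].
Proof.
move=> oB oC BC.
suff : reaches (A :\: C) B o \/
       exists x y, [/\ x \in C, e x y & reaches (A :\: C) B y].
  case=> // /existsP[b /andP[_ /andP[]]]; by rewrite inE oC.
move: o oB {oC}; apply: reaches_ind => [y yA yB|x z xA exz _].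
  by left; apply: reaches_refl => //; rewrite inE yA (disjointFr BC yB).
case=> [zB|]; last by right.
have [xC|xC] := boolP (x \in C); first by right; exists x, z.
by left; apply: reaches_step exz zB; rewrite inE xC.
Qed.

(** After its last visit to [C] the path leaves [S], because an occupied neighbour of [C] in [S]
    belongs to [C]. For the same reason the rest of the path avoids the shell, whose vertices off
    [C] are empty. *)
Lemma cluster_exit A B S C o : reaches A B o -> o \in S -> [disjoint B & S] ->
  cluster (A :&: S) o = C ->
  o \in C /\ exists y, [/\ y \notin S, [exists x in C, e x y]
                         & reaches (A :\: shell S C) B y].
Proof.
move=> oB oS BS CE.
have oA : o \in A by case/existsP: oB => b /andP[_ /andP[]].
have oC : o \in C by rewrite -CE inE conn_refl// inE oA.
have CS : C \subset S.
  by rewrite -CE; apply/subsetP => x; rewrite inE => /conn_memr; rewrite inE => /andP[].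
have closedC x y : x \in C -> e x y -> y \in A -> y \in S -> y \in C.
  rewrite -{1}CE !inE => ox exy yA yS; rewrite -CE inE.
  by apply: conn_stepr ox exy _; rewrite inE yA.
split=> //; have [|x [y [xC exy yB]]] := last_exit oB oC.
  exact: disjointWr CS BS.
have yA : y \in A :\: C by case/existsP: yB => b /andP[_ /andP[]].
exists y; split; last 1 first.
- apply: reaches_sub yB; apply/subsetP => z; rewrite /shell !inE => /andP[zC zA].
  rewrite zA (negbTE zC) /= andbT negb_and -implybE; apply/implyP => zS.
  by apply/negP => /existsP[w /andP[wC ewz]]; rewrite (closedC w z) in zC.
- by move: yA; rewrite inE => /andP[yC yA]; apply: contra yC; exact: closedC exy yA.
- by apply/existsP; exists x; rewrite xC.
Qed.

End Clusters.

(** * The two inequalities for phi *)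

Section Percolation.
Import boot.fintype boot.finset.
Variables (R : realFieldType) (T : finType) (e : rel T) .
Variables (r : T -> R) (r01 : forall x, 0 <= r x <= 1).
Implicit Types (A B C D S : {set T}) (x y z o : T).

(* For [S] disjoint from the boundary of the box, [phi S o] does not depend on
   the box. *)
Definition phi S o : R :=
  \sum_(y | y \notin S) prob r (fun A => reaches_nbr e (A :&: S) o y).

Lemma sum_pivotal_ge B o (k : R) : 0 <= k <= 1 ->
  (forall S, o \in S -> [disjoint B & S] -> k <= phi S o) ->
  k * (1 - r o) <= \sum_y prob r (fun A =>
    [&& y \notin A, ~~ reaches e A B o & reaches e (y |: A) B o]).
Proof.
move=> /andP[k0 k1] phik.
pose piv y := fun A => [&& y \notin A, ~~ reaches e A B o & reaches e (y |: A) B o].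
pose f A := ~: wired e A B.
have fE A S : (f A == S) = (wired e A B == ~: S) by rewrite (can2_eq setCK setCK).
rewrite -(prob_notin r o) (prob_partition f) big_distrr /=.
rewrite (eq_bigr (fun y => \sum_S prob r (fun A => piv y A && (f A == S)))); last first.
  by move=> y _; rewrite (prob_partition f).
rewrite exchange_big /=; apply: ler_sum => S _.
have p0 E : 0 <= prob r E by exact: prob_ge0.
(* When [o] is wired, the pivotality of [o] alone supplies the bound, by [k <= 1]; this is why [o]
   is required to be empty on the left-hand side. *)
have [oS|oS] := boolP (o \in S); last first.
  rewrite (bigD1 o)//=; apply: (@le_trans _ _ (prob r (fun A => piv o A && (f A == S)))).
    apply: le_trans (ler_piMl _ k1) _ => //.
    apply: le_prob => // A /andP[oA fS]; rewrite fS andbT; apply: pivotal_source => //.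
    by move: fS; rewrite fE => /eqP ->; rewrite inE.
  by rewrite lerDl; apply: sumr_ge0.
have [BS|BS] := boolP [disjoint B & S]; last first.
  (* [B] is always wired, so an [S] meeting [B] never occurs. *)
  have -> : prob r (fun A => (o \notin A) && (f A == S)) = 0.
    apply: big1 => A /andP[_ /eqP fS]; exfalso; case/negP: BS.
    by rewrite -setI_eq0 -fS -subset0; apply/subsetP => x; rewrite !inE => /andP[->].
  by rewrite mulr0; apply: sumr_ge0.
apply: (@le_trans _ _ (phi S o * prob r (fun A => f A == S))).
  apply: ler_pM => //; first exact: phik.
  by apply: le_prob => // A /andP[].
rewrite /phi big_distrl /= big_mkcond; apply: ler_sum => y _.
case: ifP => // yS; rewrite -(@prob_indep _ _ r S); last 2 first.
- by move=> A; rewrite -setIA setIid.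
- by move=> A; rewrite !fE wired_local.
apply: le_prob => // A /= /andP[/existsP[x /andP[exy ox]] fS].
rewrite fS andbT; apply: (pivotal_of_wired _ oS ox exy yS).
by apply/eqP; rewrite -fE.
Qed.

(** Sum over the cluster [C] of [o] inside [S]. It is determined on the shell, while the
    continuation from the exit vertex lives off the shell, so the two are independent; the
    restriction on the continuation is then dropped by monotonicity. *)
Lemma prob_reaches_le B S o : o \in S -> [disjoint B & S] ->
  prob r (fun A => reaches e A B o) <=
  \sum_(y | y \notin S) prob r (fun A => reaches_nbr e (A :&: S) o y) *
                        prob r (fun A => reaches e A B y).
Proof.
move=> oS BS.
pose cl A := cluster e (A :&: S) o.
pose nbr C y := [exists x in C, e x y].
rewrite (prob_partition cl).
rewrite [leRHS](eq_bigr (fun y => \sum_(C : {set T} | nbr C y) 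
   (prob r (fun A => cl A == C) * prob r (fun A => reaches e A B y)))); last first.
  move=> y _; rewrite -big_distrl /=; congr (_ * _).
  rewrite (prob_partition cl) [RHS]big_mkcond; apply: eq_bigr => C _.
  have nbrE A : cl A == C -> reaches_nbr e (A :&: S) o y = nbr C y.
    move=> /eqP <-; apply/existsP/existsP => -[x /andP[]].
      by move=> exy ox; exists x; rewrite inE ox.
    by rewrite inE => ox exy; exists x; rewrite exy.
  case nCy : (nbr C y).
    by apply: eq_prob => A; case: eqP => [/eqP /nbrE ->|_]; rewrite ?andbF ?nCy.
  by apply: big1 => A /andP[+ /nbrE]; rewrite nCy => ->.
rewrite [leRHS](exchange_big_dep xpredT) //=; apply: ler_sum => C _.
have p0 E : 0 <= prob r E by exact: prob_ge0.
have [oC|oC] := boolP (o \in C); last first.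
  rewrite {1}/prob big1.
    by apply: sumr_ge0 => y _; exact: mulr_ge0.
  by move=> A /andP[oB /eqP /(cluster_exit oB oS BS) []]; rewrite (negbTE oC).
apply: (@le_trans _ _ (\sum_(y | (y \notin S) && nbr C y)
    prob r (predI (fun A => cl A == C) (fun A => reaches e (A :\: shell e S C) B y)))).
  apply: prob_union => // A /andP[oB clC].
  have [_ [y [yS Cy yB]]] := cluster_exit oB oS BS (eqP clC).
  by exists y; rewrite /= ?yS ?clC.
apply: ler_sum => y _; rewrite (@prob_indep _ _ r (shell e S C)).
- by apply: ler_wpM2l => //; apply: le_prob => // A; apply: reaches_sub; exact: subsetDl.
- by move=> A; rewrite /cl cluster_local.
- by move=> A; rewrite setDDl setUid.
Qed.

End Percolation.

Local Open Scope classical_set_scope.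
Local Open Scope ring_scope.

(** * Geometry of the lattice *)

Section Lattice.
Variable d : nat.
Implicit Types (x y z : 'rV[int]_d).

Lemma linf_normP x n :
  reflect (forall i, (`|x ord0 i| <= n)%N) (linf_norm x <= n)%N.
Proof.
by apply: (iffP (bigmax_leqP _ _ _)) => [h i|h i _]; exact: h.
Qed.

Lemma linf_norm0 : linf_norm (0 : 'rV[int]_d) = 0%N.
Proof.
by apply/eqP; rewrite -leqn0; apply/linf_normP => i; rewrite mxE.
Qed.

Lemma linf_normD x y : (linf_norm (x + y) <= linf_norm x + linf_norm y)%N.
Proof.
have abszD (a b : int) : (`|(a + b)%R| <= `|a| + `|b|)%N by lia.
apply/linf_normP => i; rewrite mxE; apply: leq_trans (abszD _ _) _.
by apply: leq_add; apply/linf_normP.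
Qed.

Lemma linf_norm_le_l1dist x y : (linf_norm (x - y) <= l1dist x y)%N.
Proof.
by apply/linf_normP => i; rewrite /l1dist (bigD1 i)//= !mxE leq_addr.
Qed.

Lemma l1distC x y : l1dist x y = l1dist y x.
Proof. by apply: eq_bigr => i _; rewrite distnC. Qed.

Lemma l1dist_translate z x y : l1dist (x + z) (y + z) = l1dist x y.
Proof. by apply: eq_bigr => i _; rewrite !mxE opprD addrACA subrr addr0. Qed.

Lemma finite_linf_ball n : finite_set [set x : 'rV[int]_d | (linf_norm x <= n)%N].
Proof.
pose f (k : 'I_(n + n).+1) : int := k%:Z - n%:Z.
apply: (@sub_finite_set _ _ (map_mx f @` [set: 'rV_d])).
  move=> x /= /linf_normP xn.
  exists (\row_i inord `|(x ord0 i + n%:Z)%R|%N) => //.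
  apply/rowP => i; rewrite !mxE /f.
  by set u : int := x _ _; have un : (`|u| <= n)%N := xn i; rewrite inordK; lia.
by apply: finite_image; exact: finite_finset.
Qed.

Lemma odd_num_odd x : odd (num_odd x) = odd (\sum_(i < d) `|x ord0 i|)%N.
Proof.
rewrite /num_odd -sum1_card big_mkcond /= !(big_morph odd oddD (erefl _)).
by apply: eq_bigr => i _; rewrite inE; case: ifP.
Qed.

Lemma odd_l1dist x y : odd (l1dist x y) = odd (num_odd x) (+) odd (num_odd y).
Proof.
rewrite !odd_num_odd /l1dist !(big_morph odd oddD (erefl _)) -big_split /=.
apply: eq_bigr => i _; rewrite -oddD.
by set u : int := x _ _; set v : int := y _ _; lia.
Qed.

Lemma num_odd0P x : reflect (forall i, ~~ odd `|x ord0 i|) (num_odd x == 0%N).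
Proof.
apply: (iffP eqP) => [/card0_eq h i|h]; first by have := h i; rewrite inE => ->.
by apply: eq_card0 => i; rewrite inE; exact/negbTE/h.
Qed.

Lemma num_odd_translate z x : num_odd z = 0%N -> num_odd (x + z) = num_odd x.
Proof.
move=> /eqP/num_odd0P z0; apply: eq_card => i; rewrite !inE mxE.
by set u : int := x _ _; have : ~~ odd `|z ord0 i| := z0 i; set v : int := z _ _; lia.
Qed.

End Lattice.

(** * Boxes, occupied paths and even translations *)

Section Vertices.
Variable d : nat.
Implicit Types (x y z : vertex d) (w : vertex d -> bool) (n m : nat).

Lemma adj_sym : symmetric (@adj d).
Proof. by move=> x y; rewrite /adj l1distC. Qed.

Lemma adj_linf_normB x y : adj x y -> (linf_norm (val x - val y) <= 1)%N.
Proof. by move=> /eqP xy; apply: leq_trans (linf_norm_le_l1dist _ _) _; rewrite xy. Qed.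

Lemma adj_linf_norm x y : adj x y -> (linf_norm (val x) <= (linf_norm (val y)).+1)%N.
Proof.
move=> /adj_linf_normB xy; rewrite -{1}[val x](subrK (val y)).
by apply: leq_trans (linf_normD _ _) _; rewrite -[leqRHS]add1n leq_add2r.
Qed.

(** A unit step changes the parity of the number of odd coordinates, which is [0] or [1] on
    vertices: the graph is bipartite. *)
Lemma adj_site x y : adj x y -> ~~ is_site x -> is_site y.
Proof.
rewrite /is_site => /eqP xy; have := odd_l1dist (val x) (val y); rewrite xy.
have := valP x; have := valP y => /=.
by case: (num_odd (val x)) => [|[|]]//; case: (num_odd (val y)) => [|[|]].
Qed.

Definition ball n : {fset vertex d} :=
  fset_set [set x : vertex d | (linf_norm (val x) <= n)%N].

Lemma finite_vertex_ball n :
  finite_set [set x : vertex d | (linf_norm (val x) <= n)%N].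
Proof.
apply: (@finite_preimage _ _ [set x : 'rV[int]_d | (linf_norm x <= n)%N] val).
  by move=> x y _ _; exact: val_inj.
exact: finite_linf_ball.
Qed.

Lemma in_ball n x : (x \in ball n) = (linf_norm (val x) <= n)%N.
Proof.
rewrite in_fset_set; last exact: finite_vertex_ball.
by apply/idP/idP => [/set_mem//|?]; apply/mem_set.
Qed.

Definition ball_adj n : rel (ball n) := fun x y : ball n => adj (val x) (val y).

Definition ball_boundary n : {set ball n} :=
  finset (fun x : ball n => linf_norm (val (val x)) == n).

Definition occupied n w : {set ball n} := finset (fun x : ball n => w (val x)).

Lemma reaches_open_path n w (x : ball n) :
  reaches (@ball_adj n) (occupied n w) (ball_boundary n) x ->
  exists2 y, box_boundary n y & open_path w (val x) y.
Proof.
move: x; apply: reaches_ind => [y yA yB|x z xA xz _ [y yn [s [ps ls ws]]]].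
  exists (val y); first by move: yB; rewrite inE => /eqP.
  by exists [::]; split=> //=; move: yA; rewrite inE andbT.
exists y => //; exists (val z :: s); split=> //=; last by move: xA; rewrite inE => ->.
by rewrite ps andbT.
Qed.

(** The path may leave the box, so it is cut at its first vertex of norm [n]; until then a step
    raises the norm by at most one and stays in the ball. *)
Lemma open_path_reaches n w (x : ball n) y :
  open_path w (val x) y -> (n <= linf_norm (val y))%N ->
  reaches (@ball_adj n) (occupied n w) (ball_boundary n) x.
Proof.
move=> [s [+ <-]]; elim: s x => [|z s IH] x /=.
  move=> _ /andP[wx _] nx; apply: reaches_refl; rewrite inE//.
  by rewrite eqn_leq nx andbT -in_ball (valP x).
move=> /andP[xz zs] /andP[wx ws] nz.
have [xn|xn] := eqVneq (linf_norm (val (val x))) n.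
  by apply: reaches_refl; rewrite inE// xn.
have zn : z \in ball n.
  rewrite in_ball; rewrite adj_sym in xz.
  apply: leq_trans (adj_linf_norm xz) _; rewrite ltn_neqAle xn.
  by rewrite -in_ball (valP x).
apply: (@reaches_step _ _ _ _ _ [` zn]%fset); rewrite ?inE//.
exact: (IH [` zn]%fset).
Qed.

Lemma origin_ball n : origin d \in ball n.
Proof. by rewrite in_ball /= linf_norm0. Qed.

Definition ball_origin n : ball n := [` origin_ball n]%fset.

(** Radius [0] is excluded because there the convention connects the origin to the boundary even
    when the origin is empty. *)
Lemma connected_to_reaches n w : (0 < n)%N ->
  connected_to w (origin d) (@box_boundary d n) <->
  reaches (@ball_adj n) (occupied n w) (ball_boundary n) (ball_origin n).
Proof.
move=> n0; split.
  case=> [/= o0|[y yn oy]]; first by move: n0; rewrite -o0 linf_norm0.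
  by apply: (@open_path_reaches _ _ (ball_origin n) _ oy); rewrite -yn.
by move/reaches_open_path => [y yn oy]; right; exists y.
Qed.

Lemma open_path_connected_to n w y :
  open_path w (origin d) y -> (n <= linf_norm (val y))%N ->
  connected_to w (origin d) (@box_boundary d n).
Proof.
case: n => [|n]; first by left; rewrite /box_boundary /= linf_norm0.
move=> oy ny; apply/connected_to_reaches => //.
exact: (@open_path_reaches _ _ (ball_origin n.+1) _ oy).
Qed.

Lemma connected_to_le m n w : (m <= n)%N ->
  connected_to w (origin d) (@box_boundary d n) ->
  connected_to w (origin d) (@box_boundary d m).
Proof.
case: n => [|n mn]; first by rewrite leqn0 => /eqP ->.
move=> [/= o0|[y yn oy]]; first by move: o0; rewrite /box_boundary /= linf_norm0.
by apply: open_path_connected_to oy _; rewrite yn.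
Qed.

Lemma percolatesP w : percolates w <->
  forall n, connected_to w (origin d) (@box_boundary d n).
Proof.
split=> [inf n|cn fin].
  apply: contrapT => ncn; apply: inf.
  apply: sub_finite_set (finite_vertex_ball n) => y oy /=.
  by rewrite leqNgt; apply/negP => /ltnW/(open_path_connected_to oy).
pose s := fset_set (cluster_of w (origin d)).
(* One more than the largest norm in the cluster, finite by assumption. *)
pose n := (\max_(y <- s) linf_norm (val y)).+1.
have [/= o0|[y yn oy]] := cn n; first by move: o0; rewrite /box_boundary /= linf_norm0.
have : (linf_norm (val y) < n)%N.
  rewrite ltnS; apply: (@leq_bigmax_seq _ _ xpredT (fun z => linf_norm (val z))) => //.
  by rewrite in_fset_set//; exact/mem_set.
by rewrite yn ltnn.
Qed.

(* Junk value [x] if [val x + u] is not a vertex; only used for even [u]. *)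
Definition translate (u : 'rV[int]_d) x : vertex d := insubd x (val x + u).

Lemma val_translate u x : num_odd u = 0%N -> val (translate u x) = val x + u.
Proof.
move=> u0; rewrite /translate val_insubd num_odd_translate//.
by rewrite (valP x).
Qed.

Lemma num_oddN u : num_odd (- u : 'rV[int]_d) = num_odd u.
Proof. by apply: eq_card => i; rewrite !inE mxE abszN. Qed.

Lemma translateK u : num_odd u = 0%N -> cancel (translate (- u)) (translate u).
Proof.
by move=> u0 x; apply: val_inj; rewrite !val_translate ?num_oddN// subrK.
Qed.

Lemma adj_translate u x y : num_odd u = 0%N ->
  adj (translate u x) (translate u y) = adj x y.
Proof. by move=> u0; rewrite /adj !val_translate// l1dist_translate. Qed.

Lemma is_site_translate u x : num_odd u = 0%N ->
  is_site (translate u x) = is_site x.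
Proof. by move=> u0; rewrite /is_site val_translate// num_odd_translate. Qed.

(** Recentre the path at [z]: evenness keeps the shifted points in the vertex set, and the triangle
    inequality keeps the end at norm at least [m]. *)
Lemma open_path_translate w z y m : is_site z -> open_path w z y ->
  (m + linf_norm (val z) <= linf_norm (val y))%N ->
  connected_to (w \o translate (val z)) (origin d) (@box_boundary d m).
Proof.
move=> /eqP z0 [s [ps ls ws]] my; have z0' : num_odd (- val z) = 0%N by rewrite num_oddN.
have zo : translate (- val z) z = origin d.
  by apply: val_inj; rewrite val_translate// subrr.
apply: (@open_path_connected_to _ _ (translate (- val z) y)); last first.
  rewrite val_translate// -(leq_add2r (linf_norm (val z))).
  apply: leq_trans my _; rewrite -{1}[val y](subrK (val z)).
  exact: linf_normD.
exists (map (translate (- val z)) s); rewrite -zo; split.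
- rewrite (map_path (e' := @adj d) (b := pred0)) //; last by apply/hasPn.
  by move=> a b _; rewrite adj_translate.
- by rewrite last_map ls.
- rewrite -map_cons all_map; apply: sub_all ws => a /= wa.
  by rewrite translateK.
Qed.

(** A path from a bond first steps onto a site, so [u] is zero or that step. The step may use up one
    unit of norm, which the strict inequality provides. *)
Lemma reaches_translate n m w (y : ball n) :
  reaches (@ball_adj n) (occupied n w) (ball_boundary n) y ->
  (m + linf_norm (val (val y)) < n)%N ->
  exists u : 'rV[int]_d, [/\ (linf_norm u <= 1)%N, num_odd (val (val y) + u) = 0%N &
    connected_to (w \o translate (val (val y) + u)) (origin d) (@box_boundary d m)].
Proof.
move=> yB myn; have [ys|ys] := boolP (is_site (val y)).
  exists 0; rewrite linf_norm0 addr0; split=> //; first exact/eqP.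
  have [b bn yb] := reaches_open_path yB.
  by apply: open_path_translate yb _ => //; rewrite bn ltnW.
have [|z yz zB] := reaches_next yB.
  by rewrite inE; apply/negP => /eqP yn; move: myn; rewrite yn; lia.
have zs := adj_site yz ys.
have [b bn zb] := reaches_open_path zB.
exists (val (val z) - val (val y)); rewrite [val (val y) + _]addrC subrK.
split; last 1 first.
- apply: open_path_translate zb _ => //; rewrite bn.
  have := yz; rewrite /ball_adj adj_sym => /adj_linf_norm zy.
  by apply: leq_trans myn; rewrite -addnS leq_add2l.
- by have := yz; rewrite /ball_adj adj_sym => /adj_linf_normB.
- exact/eqP.
Qed.

End Vertices.

(** * Finite boxes and the law of the percolation *)

Section Embedding.
Variables (T T' : finType) (e : rel T) (e' : rel T') (i : T -> T').
Hypotheses (i_inj : injective i) (ei : forall x y, e' (i x) (i y) = e x y).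

(** Serves to identify clusters in a box with clusters in its copy inside a larger box. *)
Lemma conn_imset (A : {set T}) x y :
  conn e' (i @: A)%SET (i x) (i y) = conn e A x y.
Proof.
apply/idP/idP.
- suff step z : conn e' (i @: A)%SET z (i y) -> forall x, z = i x -> conn e A x y.
    by move=> /step; exact.
  move: z; apply: conn_ind => [|z z' zA zz' z'y IH x' zE].
    by rewrite mem_imset// => yA x' /i_inj <-; exact: conn_refl.
  case/andP: z'y => /imsetP[w wA z'E] _.
  move: zA zz'; rewrite zE z'E mem_imset// ei => x'A x'w.
  by apply: conn_step x'A x'w _; exact: IH.
- move: x; apply: conn_ind => [yA|x z xA xz _ IH].
    by apply: conn_refl; rewrite mem_imset.
  by apply: (@conn_step _ _ _ _ (i z)); rewrite ?mem_imset ?ei.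
Qed.

Lemma reaches_nbr_imset (A : {set T}) x y :
  reaches_nbr e' (i @: A)%SET (i x) (i y) = reaches_nbr e A x y.
Proof.
apply/existsP/existsP => -[z /andP[zy xz]].
  have /imsetP[w _ zE] := conn_memr xz.
  by exists w; move: zy xz; rewrite zE ei conn_imset => -> ->.
by exists (i z); rewrite ei conn_imset zy.
Qed.

Lemma setI_imset (A' : {set T'}) (S : {set T}) :
  (A' :&: i @: S = i @: ((i @^-1: A') :&: S))%SET.
Proof.
apply/setP => y; rewrite inE; apply/andP/imsetP => [[yA /imsetP[x xS yE]]|[x]].
  by exists x; rewrite // !inE xS -yE yA.
by rewrite !inE => /andP[xA xS] ->; rewrite mem_imset.
Qed.

End Embedding.

(** * Percolation events as events on finite boxes *)

Section Bridge.
Variables (R : realType) (d : nat).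
Implicit Types (p q : R) (x : vertex d).

Definition rate p q x : R := if is_site x then q else p.

Lemma rate01 p q x : 0 <= p <= 1 -> 0 <= q <= 1 -> 0 <= rate p q x <= 1.
Proof. by move=> p01 q01; rewrite /rate; case: ifP. Qed.

Variables (dsp : measure_display) (Omega : measurableType dsp).
Implicit Types (omega : vertex d -> Omega -> bool) (P : probability Omega R).

(** The event is a finite disjoint union of cylinders, one for each configuration on [T] satisfying
    [E], and the product rule evaluates each of them as a [weight]. *)
Lemma prob_bridge omega P p q (T : finType) (h : T -> vertex d)
    (E : pred {set T}) :
  site_bond_percolation omega P p q -> injective h ->
  let Ev := [set o | E (finset (fun z => omega (h z) o))] in
  measurable Ev /\ P Ev = (prob (rate p q \o h) E)%:E.
Proof.
move=> [mo Po indep] hinj Ev.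
(* A singleton: the state that [A] prescribes at [x]. *)
pose B (A : {set T}) (x : vertex d) : set bool := [set x \in map h (enum A)].
pose V := map h (enum T).
pose F (A : {set T}) := \bigcap_(x in [set` V]) (omega x @^-1` B A x).
have mpre x (Y : set bool) : measurable (omega x @^-1` Y).
  by rewrite -[X in measurable X]setTI; apply: mo.
have BhE A z : B A (h z) = [set z \in A].
  by rewrite /B mem_map// mem_enum.
have FE A o : F A o <-> finset (fun z => omega (h z) o) = A.
  split=> [FA|<- x /= /mapP[z _ ->]].
    apply/setP => z; rewrite inE.
    have /(_ (h z)) : F A o by []; rewrite /= BhE; apply.
    by rewrite /V/= map_f// mem_enum.
  by rewrite BhE inE.
have mF A : measurable (F A).
  by apply: fin_bigcap_measurable => [|x _]; [exact: finite_seq|exact: mpre].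
have PF A : P (F A) = (weight (rate p q \o h) A)%:E.
  rewrite /F indep; last by rewrite map_inj_uniq ?enum_uniq.
  rewrite /weight big_map -prodEFin big_enum; apply: eq_bigr => z _.
  rewrite BhE /= /rate; case: (z \in A).
    rewrite -Po; congr (P _); apply/seteqP; split=> o /=; by [move=> ->|].
  rewrite [X in _ = X]EFinB -Po -probability_setC; last first.
    by have := mpre (h z) [set true]; congr measurable; apply/seteqP; split.
  congr (P _); apply/seteqP; split=> o /=; first by move=> ->.
  by move/negP/negbTE.
have EvE : Ev = \bigcup_(A in [set` enum E]) F A.
  apply/seteqP; split=> o /=.
    by move=> Eo; exists (finset (fun z => omega (h z) o));
      rewrite /= ?mem_enum//; exact/FE.
  by move=> [A /=]; rewrite mem_enum => EA /FE AE; rewrite /Ev /= AE.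
rewrite EvE; split.
  by apply: fin_bigcup_measurable => //; exact: finite_seq.
rewrite measure_fin_bigcup//; last by move=> A A' _ _ [a [/FE AE /FE AE']]; rewrite -AE.
rewrite -(fsbig_seq _ _ (enum_uniq E)) big_enum /= /prob -sumEFin.
by apply: eq_bigr => A _; exact: PF.
Qed.

Definition ball_rate n p q (x : ball d n) : R := rate p q (val x).

Definition ball_prob n p q : R := prob (@ball_rate n p q) (fun A =>
  reaches (@ball_adj d n) A (ball_boundary d n) (ball_origin d n)).

Lemma connected_to_bridge omega P p q n :
  site_bond_percolation omega P p q -> (0 < n)%N ->
  let Ev := [set o | connected_to (omega ^~ o) (origin d) (@box_boundary d n)] in
  measurable Ev /\ P Ev = (ball_prob n p q)%:E.
Proof.
move=> law n0 Ev.
have [] := @prob_bridge omega P p q _ (val : ball d n -> vertex d)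
  (fun A => reaches (@ball_adj d n) A (ball_boundary d n) (ball_origin d n)) law val_inj.
suff -> : [set o | reaches (@ball_adj d n) (finset (fun z : ball d n => omega (val z) o))
   (ball_boundary d n) (ball_origin d n)] = Ev by [].
by apply/seteqP; split=> o /= /(connected_to_reaches (omega ^~ o) n0).
Qed.

Lemma connected_to0 w : connected_to w (origin d) (@box_boundary d 0).
Proof. by left; rewrite /box_boundary /= linf_norm0. Qed.

Lemma measurable_connected_to omega P p q n :
  site_bond_percolation omega P p q ->
  measurable [set o | connected_to (omega ^~ o) (origin d) (@box_boundary d n)].
Proof.
move=> law; case: n => [|n]; last by have [] := connected_to_bridge law (ltn0Sn n).
by rewrite (_ : mkset _ = setT)//; apply/seteqP; split=> // o _; exact: connected_to0.
Qed.

Lemma percolates_bigcap omega :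
  [set o | percolates (omega ^~ o)] =
  \bigcap_n [set o | connected_to (omega ^~ o) (origin d) (@box_boundary d n)].
Proof.
apply/seteqP; split=> o /=; first by move=> /percolatesP oo n _; exact: oo.
by move=> oo; apply/percolatesP => n; exact: oo.
Qed.

Section Theta.
Variables (omega : vertex d -> Omega -> bool) (P : R -> R -> probability Omega R).
Variables (p q : R) (law : site_bond_percolation omega (P p q) p q).

Lemma theta_n0 : theta_n omega P 0 p q = 1.
Proof.
rewrite /theta_n (_ : mkset _ = setT) ?probability_setT//.
by apply/seteqP; split=> // o _; exact: connected_to0.
Qed.

Lemma theta_nE n : (0 < n)%N -> theta_n omega P n p q = ball_prob n p q.
Proof. by move=> n0; rewrite /theta_n (connected_to_bridge law n0).2. Qed.

Lemma theta_n_ge0 n : 0 <= theta_n omega P n p q.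
Proof. by rewrite fine_ge0. Qed.

Lemma theta_n_le1 n : theta_n omega P n p q <= 1.
Proof.
rewrite -lee_fin fineK ?fin_num_measure//; last exact: measurable_connected_to law.
by apply: probability_le1; exact: measurable_connected_to law.
Qed.

Lemma measurable_percolates : measurable [set o | percolates (omega ^~ o)].
Proof.
rewrite percolates_bigcap; apply: bigcapT_measurable => n.
exact: measurable_connected_to law.
Qed.

Lemma theta_le_theta_n n : theta omega P p q <= theta_n omega P n p q.
Proof.
apply: fine_le; rewrite ?fin_num_measure//.
- exact: measurable_percolates.
- exact: measurable_connected_to law.
- apply: le_measure.
  + exact/mem_set/measurable_percolates.
  + exact/mem_set/(measurable_connected_to _ law).
  + by rewrite percolates_bigcap => o; exact.
Qed.

(** Continuity of the measure from above, along the decreasing crossing events. *)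
Lemma theta_ge (a : R) : (forall n, a <= theta_n omega P n p q) ->
  a <= theta omega P p q.
Proof.
move=> an; pose F n := [set o | connected_to (omega ^~ o) (origin d) (@box_boundary d n)].
have mF n : measurable (F n) by exact: measurable_connected_to law.
have : P p q \o F @ \oo --> P p q (\bigcap_n F n).
  apply: nonincreasing_cvg_mu => //.
  - by rewrite -ge0_fin_numE// fin_num_measure.
  - exact: bigcapT_measurable.
  - by move=> m n mn; apply/subsetPset => o; exact: connected_to_le.
rewrite -percolates_bigcap => cv.
rewrite -lee_fin fineK ?fin_num_measure//; last exact: measurable_percolates.
apply: (cvge_to_ge cv); near=> n.
by rewrite /= -[leRHS]fineK ?fin_num_measure// lee_fin; exact: an.
Unshelve. all: by end_near. Qed.

End Theta.
End Bridge.

(** * Exponential decay *)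

Section ExponentialDecay.
Variables (R : realType) (d : nat) (dsp : measure_display).
Variables (Omega : measurableType dsp) (omega : vertex d -> Omega -> bool).
Variables (P : R -> R -> probability Omega R) (p q : R).
Hypotheses (p01 : 0 <= p <= 1) (q01 : 0 <= q <= 1).
Hypothesis law : site_bond_percolation omega (P p q) p q.

Definition unit_ball : {fset 'rV[int]_d} :=
  fset_set [set u : 'rV[int]_d | (linf_norm u <= 1)%N].

(** An even translation permutes the vertices and preserves sites and bonds, so it only relabels the
    finite families in the product rule. *)
Lemma translate_law (u : 'rV[int]_d) : num_odd u = 0%N ->
  site_bond_percolation (omega \o translate u) (P p q) p q.
Proof.
move=> u0; have [mo Po indep] := law.
have tK : cancel (translate u) (translate (- u) : vertex d -> vertex d).
  by move=> x; have := @translateK d (- u) _ x; rewrite opprK; apply; rewrite num_oddN.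
have tK' : cancel (translate (- u) : vertex d -> vertex d) (translate u).
  exact: translateK.
split=> [x|x|A B uA]; first exact: mo.
  by rewrite /= Po is_site_translate.
have := indep (map (translate u) A) (B \o translate (- u)).
rewrite map_inj_uniq//; last exact: can_inj tK.
move=> /(_ uA); rewrite big_map => indepA.
have -> : (\prod_(x <- A) P p q ((omega \o translate u) x @^-1` B x) =
  \prod_(j <- A) P p q (omega (translate u j) @^-1` (B \o translate (- u)) (translate u j)))%E.
  by apply: eq_bigr => x _; rewrite /= tK.
rewrite -indepA; congr (P p q _); apply/seteqP; split=> o ho x /=.
  by move=> /mapP[y yA ->]; rewrite tK; exact: ho.
by move=> xA; have := ho (translate u x); rewrite /= tK; apply; exact: map_f.
Qed.

Lemma theta_n_translate (u : 'rV[int]_d) n : num_odd u = 0%N ->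
  P p q [set o | connected_to ((omega ^~ o) \o translate u) (origin d) (@box_boundary d n)]
    = (theta_n omega P n p q)%:E.
Proof.
move=> u0; have law' := translate_law u0.
rewrite -(@fineK _ (P p q _)) ?fin_num_measure//; last exact: (measurable_connected_to n law').
case: n => [|n]; last first.
  rewrite (theta_nE law)//; have [_ ] := connected_to_bridge law' (ltn0Sn n).
  by rewrite /= => ->.
rewrite theta_n0; congr EFin.
exact: (theta_n0 (omega \o translate u) (fun _ _ => P p q) p q).
Qed.

(** Union bound over the shifts given by [reaches_translate]; by translation invariance each
    resulting event has probability [theta_n omega P m p q]. *)
Lemma prob_reaches_le_theta n m (y : ball d n) :
  (m + linf_norm (val (val y)) < n)%N ->
  prob (@ball_rate R d n p q) (fun A => reaches (@ball_adj d n) A (ball_boundary d n) y)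
  <= theta_n omega P m p q *+ #|` unit_ball|.
Proof.
move=> myn.
have [mE PE] := @prob_bridge R d _ _ omega (P p q) p q _ (val : ball d n -> vertex d)
  (fun A => reaches (@ball_adj d n) A (ball_boundary d n) y) law val_inj.
pose D := [set u : 'rV[int]_d | (linf_norm u <= 1)%N /\ num_odd (val (val y) + u) = 0%N].
have Dsub : D `<=` [set u : 'rV[int]_d | (linf_norm u <= 1)%N] by move=> u [].
have Dfin : finite_set D by apply: sub_finite_set Dsub _; exact: finite_linf_ball.
pose F u := [set o | connected_to ((omega ^~ o) \o translate (val (val y) + u))
  (origin d) (@box_boundary d m)].
have F0 u : D u -> P p q (F u) = (theta_n omega P m p q)%:E.
  by move=> [_ u0]; rewrite /F theta_n_translate.
rewrite -lee_fin -PE; apply: (@le_trans _ _ (\sum_(u \in D) P p q (F u))%E).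
  apply: content_sub_fsum => //.
    by move=> u [_ u0]; exact: (measurable_connected_to m (translate_law u0)).
  move=> o /= oB; have [u [u1 u0 cu]] := @reaches_translate d n m (omega ^~ o) y oB myn.
  by exists u.
rewrite fsbig_finite//= big_seq (eq_bigr (fun=> (theta_n omega P m p q)%:E)); last first.
  by move=> u; rewrite in_fset_set// => /set_mem /F0.
rewrite -big_seq sumEFin lee_fin big_const_seq count_predT iter_addr addr0.
apply: ler_wpMn2l; first exact: theta_n_ge0.
apply: fsubset_leq_card; rewrite -fset_set_sub//.
exact: finite_linf_ball.
Qed.

(** Both sides are the probability of one percolation event, described through each of the two
    boxes. *)
Lemma prob_restrict_ball n m (le_nm : (n <= m)%N) (E : pred {set ball d n})
    (i : ball d n -> ball d m) : (forall x, val (i x) = val x) ->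
  prob (@ball_rate R d m p q) (fun A => E (i @^-1: A)%SET) =
  prob (@ball_rate R d n p q) E.
Proof.
move=> vi.
have [_ Pn] := @prob_bridge R d _ _ omega (P p q) p q _ (val : ball d n -> vertex d)
  E law val_inj.
have [_ Pm] := @prob_bridge R d _ _ omega (P p q) p q _ (val : ball d m -> vertex d)
  (fun A => E (i @^-1: A)%SET) law val_inj.
apply: EFin_inj; rewrite -[RHS]Pn -[LHS]Pm; congr (P p q _).
apply: eq_set => o; congr (is_true (E _)).
by apply/setP => x; rewrite !inE vi.
Qed.

Lemma theta_n_step n N (S : {set ball d n}) : (n < N)%N ->
  ball_origin d n \in S -> [disjoint ball_boundary d n & S]%B ->
  theta_n omega P N p q <=
    phi (@ball_adj d n) (@ball_rate R d n p q) S (ball_origin d n) *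
    (theta_n omega P (N - n.+1) p q *+ #|` unit_ball|).
Proof.
move=> nN oS BS.
have ltN : (0 < N)%N by case: (N) nN.
have sub x : x \in ball d n -> x \in ball d N.
  by rewrite !in_ball => /leq_trans -> //; exact: ltnW.
pose i (x : ball d n) : ball d N := [` sub _ (valP x)]%fset.
have iinj : injective i by move=> x y /(congr1 val) /= /val_inj.
have ei x y : ball_adj (i x) (i y) = ball_adj x y by [].
have r01 k x : 0 <= @ball_rate R d k p q x <= 1 by exact: rate01.
have oE : i (ball_origin d n) = ball_origin d N by exact: val_inj.
have oS' : ball_origin d N \in (i @: S)%SET by rewrite -oE mem_imset.
have BS' : [disjoint ball_boundary d N & (i @: S)%SET]%B.
  rewrite disjoint_sym; apply/pred0Pn => -[x /= /andP[/imsetP[y _ ->]]].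
  by rewrite inE => /eqP yN; move: nN; rewrite -yN ltnNge -in_ball (valP y).
rewrite theta_nE//; apply: le_trans (prob_reaches_le (@ball_adj d N) (r01 N) oS' BS') _.
(* As [S] misses the boundary of the small box, its neighbours all lie in that box; every other [y]
   contributes zero. *)
rewrite (bigID (mem (i @: ~: S)%SET)) /= [X in _ + X]big1 ?addr0; last first.
  move=> y /andP[yS yNS].
  rewrite {1}/prob big1 ?mul0r// => A /existsP[z /andP[zy /conn_memr]].
  rewrite inE => /andP[_ /imsetP[x xS zE]]; exfalso.
  have yn : val y \in ball d n.
    have xn : (linf_norm (val (val x)) < n)%N.
      rewrite ltn_neqAle -in_ball (valP x) andbT.
      by have := disjointFl BS xS; rewrite inE => ->.
    rewrite in_ball; apply: leq_trans xn.
    by have := zy; rewrite /ball_adj adj_sym zE; exact: adj_linf_norm.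
  have yE : y = i [` yn]%fset by exact: val_inj.
  by move: yS yNS; rewrite yE !mem_imset// inE => ->.
rewrite (eq_bigl (mem (i @: ~: S)%SET)); last first.
  move=> y /=; rewrite andb_idl// => /imsetP[x xS ->]; rewrite mem_imset//.
  by move: xS; rewrite inE.
rewrite big_imset /=; last by move=> x y _ _; exact: iinj.
rewrite /phi big_distrl /= (eq_bigl (fun y => y \notin S)); last by move=> y; rewrite inE.
apply: ler_sum => y yS; apply: ler_pM; rewrite ?prob_ge0//.
  rewrite le_eqVlt; apply/orP; left; apply/eqP.
  rewrite -(@prob_restrict_ball n N (ltnW nN) _ i)//; apply: eq_prob => A.
  by rewrite -oE setI_imset// (reaches_nbr_imset iinj ei).
(* The exit vertex has norm at most [n], so with radius [N - n.+1] the total stays below [N]; the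
   spare unit pays for moving from a bond to a site. *)
apply: prob_reaches_le_theta; rewrite -[X in (_ < X)%N](subnK nN) addnS ltnS leq_add2l.
by rewrite -in_ball (valP y).
Qed.

Lemma theta_n_decay n (S : {set ball d n}) :
  ball_origin d n \in S -> [disjoint ball_boundary d n & S]%B ->
  phi (@ball_adj d n) (@ball_rate R d n p q) S (ball_origin d n) *+ #|` unit_ball| <= 2^-1 ->
  exists2 c : R, 0 < c & exists N : nat, forall k : nat, (N <= k)%N ->
    theta_n omega P k p q <= expR (- c * k%:R).
Proof.
move=> oS BS phi2.
(* Each [n.+1] units of radius gain a factor one half. *)
have pow k N : (k * n.+1 <= N)%N -> theta_n omega P N p q <= 2^-1 ^+ k.
  elim: k N => [|k IH] N; first by move=> _; rewrite expr0; exact: (theta_n_le1 law).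
  rewrite mulSn => kN.
  have nN : (n < N)%N by apply: leq_trans kN; exact: leq_addr.
  apply: le_trans (theta_n_step nN oS BS) _.
  rewrite mulrnAr -mulrnAl exprS; apply: ler_pM => //.
  - by apply: mulrn_wge0; apply: sumr_ge0 => y _; apply: prob_ge0 => x; exact: rate01.
  - exact: theta_n_ge0.
  - by apply: IH; lia.
have M0 : 0 < n.+1%:R :> R by rewrite ltr0n.
have ln2 : 0 < ln (2 : R) by rewrite ln_gt0// ltr1n.
(* The factor [2] in the denominator absorbs the rounding: once [k >= n.+1], the integer quotient of
   [k] by [n.+1] is at least [k / (2 * n.+1)]. *)
exists (ln 2 / (2 * n.+1%:R)); first by rewrite divr_gt0// mulr_gt0.
exists n.+1 => k nk.
have le1 := leq_trunc_div k n.+1.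
apply: le_trans (pow (k %/ n.+1)%N k le1) _.
have -> : 2^-1 ^+ (k %/ n.+1) = expR (- ln 2 * (k %/ n.+1)%:R) :> R.
  by rewrite mulrC expRM_natl expRN lnK// posrE.
rewrite ler_expR !mulNr lerN2 -mulrA ler_pM2l// mulrC ler_pdivrMr ?mulr_gt0//.
rewrite -!natrM ler_nat.
have := ltn_ceil k (ltn0Sn n); have : (0 < k %/ n.+1)%N by rewrite divn_gt0.
nia.
Qed.

End ExponentialDecay.

(** * Derivatives *)

Section ProbCalculus.
Variables (R : realType) (T : finType).

(** The logarithmic form, valid for nonvanishing factors, yields the summands of [influence]
    directly. *)
Lemma is_derive_prod (I : Type) (s : seq I) (f : I -> R -> R) (df : I -> R) (t : R) :
  (forall i, is_derive t 1 (f i) (df i)) -> (forall i, f i t != 0) ->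
  is_derive t 1 (fun u => \prod_(i <- s) f i u)
    ((\prod_(i <- s) f i t) * \sum_(i <- s) df i / f i t).
Proof.
move=> fdf f0; elim: s => [|i s IH].
  rewrite !big_nil mulr0 (_ : (fun _ => _) = cst 1); first exact: is_derive_cst.
  by apply/funext => u; rewrite big_nil.
rewrite (_ : (fun u => _) = f i * (fun u => \prod_(j <- s) f j u)); last first.
  by apply/funext => u; rewrite big_cons.
apply: is_derive_eq; rewrite !big_cons /= /GRing.scale /=.
by field.
Qed.

Lemma is_derive_bigsum (I : Type) (s : seq I) (Q : pred I) (f : I -> R -> R)
    (df : I -> R) (t : R) :
  (forall i, is_derive t 1 (f i) (df i)) ->
  is_derive t 1 (fun u => \sum_(i <- s | Q i) f i u) (\sum_(i <- s | Q i) df i).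
Proof.
move=> fdf; elim: s => [|i s IH].
  rewrite big_nil (_ : (fun _ => _) = cst 0); first exact: is_derive_cst.
  by apply/funext => u; rewrite big_nil.
rewrite big_cons; case: ifP => Qi; last first.
  by under eq_fun do rewrite big_cons Qi.
by under eq_fun do rewrite big_cons Qi; exact: is_deriveD.
Qed.

(** Russo's formula with a separate parameter function at each vertex, so that bond and site
    parameters may move at different speeds. *)
Lemma is_derive_prob (r : T -> R -> R) (dr : T -> R) (E : pred {set T}) (t : R) :
  (forall x, is_derive t 1 (r x) (dr x)) -> (forall x, 0 < r x t < 1) ->
  is_derive t 1 (fun u => prob (r ^~ u) E)
    (\sum_y dr y * influence (r ^~ t) E y).
Proof.
move=> rdr r01.
have rn0 x : r x t != 0 by have /andP[/lt0r_neq0] := r01 x.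
have srn0 x : 1 - r x t != 0.
  by have /andP[_] := r01 x; rewrite -subr_gt0 => /lt0r_neq0.
pose f (A : {set T}) x u := if x \in A then r x u else 1 - r x u.
pose df (A : {set T}) x := if x \in A then dr x else - dr x.
have fdf A x : is_derive t 1 (f A x) (df A x).
  rewrite /f /df; case: (x \in A) => //.
  have := is_deriveB (is_derive_cst (1 : R) t 1) (rdr x).
  by rewrite sub0r.
have fn0 A x : f A x t != 0 by rewrite /f; case: ifP.
have := is_derive_bigsum (index_enum _) E (fun A => is_derive_prod (index_enum T) (fdf A) (fn0 A)).
move=> /(@is_derive_eq _ _ _ _ _ _ _ _); apply.
rewrite (eq_bigr (fun A => \sum_y dr y * (weight (r ^~ t) A *
   (if y \in A then (r y t)^-1 else - (1 - r y t)^-1)))); last first.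
  move=> A _; rewrite mulr_sumr; apply: eq_bigr => y _.
  rewrite [RHS]mulrCA; congr (_ * _); rewrite /df /f.
  by case: ifP => _; rewrite // mulrN mulNr.
by rewrite exchange_big; apply: eq_bigr => y _; rewrite -mulr_sumr.
Qed.

Lemma continuous_prob (X : topologicalType) (r : T -> X -> R) (E : pred {set T}) :
  (forall x, continuous (r x)) -> continuous (fun u => prob (r ^~ u) E).
Proof.
move=> rc.
have wc A : continuous (fun u => weight (r ^~ u) A).
  rewrite /weight; elim: (index_enum _) => [|x s IH].
    by rewrite (_ : (fun _ => _) = cst 1); [exact: cst_continuous|apply/funext => u; rewrite big_nil].
  rewrite (_ : (fun _ => _) = (fun u => if x \in A then r x u else 1 - r x u) \*
      (fun u => \prod_(j <- s) if j \in A then r j u else 1 - r j u)); last first.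
    by apply/funext => u; rewrite big_cons.
  move=> u; apply: continuousM; last exact: IH.
  case: (x \in A); first exact: rc.
  by apply: continuousB; [exact: cst_continuous|exact: rc].
rewrite /prob; elim: (index_enum _) => [|A s IH].
  by rewrite (_ : (fun _ => _) = cst 0); [exact: cst_continuous|apply/funext => u; rewrite big_nil].
case EA : (E A); last first.
  rewrite (_ : (fun _ => _) = (fun u => \sum_(j <- s | E j) weight (r ^~ u) j))//.
  by apply/funext => u; rewrite big_cons EA.
rewrite (_ : (fun _ => _) = (fun u => weight (r ^~ u) A) \+
    (fun u => \sum_(j <- s | E j) weight (r ^~ u) j)); last first.
  by apply/funext => u; rewrite big_cons EA.
by move=> u; apply: continuousD; [exact: wc|exact: IH].
Qed.

End ProbCalculus.

Section BallCalculus.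
Variables (R : realType) (d : nat).

Definition crossing n : pred {set ball d n} := fun A =>
  reaches (@ball_adj d n) A (ball_boundary d n) (ball_origin d n).

Definition bond_influence n (p q : R) : R :=
  \sum_(y : ball d n | ~~ is_site (val y)) influence (@ball_rate R d n p q) (@crossing n) y.

Definition site_influence n (p q : R) : R :=
  \sum_(y : ball d n | is_site (val y)) influence (@ball_rate R d n p q) (@crossing n) y.

Lemma is_derive_ball_prob n (f g : R -> R) (df dg t : R) :
  is_derive t 1 f df -> is_derive t 1 g dg -> 0 < f t < 1 -> 0 < g t < 1 ->
  is_derive t 1 (fun u => ball_prob d n (f u) (g u))
    (df * bond_influence n (f t) (g t) + dg * site_influence n (f t) (g t)).
Proof.
move=> fdf gdg f01 g01.
pose r (x : ball d n) (u : R) := ball_rate (f u) (g u) x.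
have rdr x : is_derive t 1 (r x) (if is_site (val x) then dg else df).
  by rewrite /r /ball_rate /rate; case: (is_site _).
have r01 x : 0 < r x t < 1 by rewrite /r /ball_rate /rate; case: ifP.
have := is_derive_prob (@crossing n) rdr r01.
move=> /(@is_derive_eq _ _ _ _ _ _ _ _); apply.
rewrite (bigID (fun y : ball d n => is_site (val y))) /= addrC !mulr_sumr.
by congr (_ + _); apply: eq_bigr => y; [move=> /negbTE ->|move=> ->].
Qed.

Lemma continuous_ball_prob n (X : topologicalType) (f g : X -> R) :
  continuous f -> continuous g -> continuous (fun u => ball_prob d n (f u) (g u)).
Proof.
move=> fc gc; apply: (@continuous_prob _ _ _ (fun x u => ball_rate (f u) (g u) x)).
by move=> x; rewrite /ball_rate /rate; case: (is_site _).
Qed.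

(** Continuity within [D] is continuity on the space [subspace D], which the preceding lemma covers
    since it allows any topological domain. *)
Lemma within_continuous_ball_prob n (D : set R) (f g : R -> R) :
  {within D, continuous f} -> {within D, continuous g} ->
  {within D, continuous (fun u => ball_prob d n (f u) (g u))}.
Proof. exact: (@continuous_ball_prob n (subspace D) f g). Qed.

Section Influence.
Variables (n : nat) (p q : R).
Hypotheses (p01 : 0 < p < 1) (q01 : 0 < q < 1).

Let r01 (x : ball d n) : 0 < ball_rate p q x < 1.
Proof. by rewrite /ball_rate /rate; case: ifP. Qed.

Let r01' (x : ball d n) : 0 <= ball_rate p q x <= 1.
Proof. by have /andP[/ltW -> /ltW ->] := r01 x. Qed.

Lemma crossing_sub (A A' : {set ball d n}) : (A \subset A')%SET ->
  crossing A -> crossing A'.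
Proof. exact: reaches_sub. Qed.

Lemma bond_influence_ge0 : 0 <= bond_influence n p q.
Proof. by apply: sumr_ge0 => y _; apply: influence_ge0 => //; exact: crossing_sub. Qed.

Lemma site_influence_ge0 : 0 <= site_influence n p q.
Proof. by apply: sumr_ge0 => y _; apply: influence_ge0 => //; exact: crossing_sub. Qed.

Lemma influence_ge (k : R) : 0 <= k <= 1 ->
  (forall S : {set ball d n}, ball_origin d n \in S ->
     [disjoint ball_boundary d n & S]%B ->
     k <= phi (@ball_adj d n) (@ball_rate R d n p q) S (ball_origin d n)) ->
  k * (1 - q) <= bond_influence n p q + site_influence n p q.
Proof.
move=> k01 phik.
have -> : bond_influence n p q + site_influence n p q =
    \sum_y influence (@ball_rate R d n p q) (@crossing n) y.
  by rewrite [RHS](bigID (fun y : ball d n => is_site (val y))) /= addrC.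
have := sum_pivotal_ge r01' k01 phik.
(* The origin is a site, so its parameter is [q]. *)
rewrite {1}/ball_rate /rate (_ : is_site _ = true); last first.
  by apply/num_odd0P => i; rewrite mxE.
move=> /le_trans; apply.
apply: ler_sum => y _; apply: (@prob_pivotal_le _ _ _ (@crossing n)) => //; exact: crossing_sub.
Qed.

End Influence.

End BallCalculus.

(** * Lower bounds for the slope from comparable partial derivatives *)

Section Slope.
Variable R : realType.

(* The chain rule gives [(theta_n \o gamma)' = a * X + b * Y] with [X], [Y] the
   partial derivatives and [(a, b)] the velocity; [X <= U * Y] is the assumed
   comparison. *)
Lemma slope_ge (a b U X Y eps : R) : 0 <= X -> 0 <= Y -> X <= U * Y ->
  eps <= b -> eps <= b + U * a -> eps * Y <= a * X + b * Y.
Proof.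
move=> X0 Y0 XUY epsb epsa.
have [a0|a0] := leP 0 a.
  by apply: le_trans (ler_wpM2r Y0 epsb) _; rewrite lerDr mulr_ge0.
apply: le_trans (ler_wpM2r Y0 epsa) _; rewrite mulrDl addrC lerD2r.
by rewrite mulrAC mulrC ler_nM2l.
Qed.

Lemma slope_ge0 (a b U X Y : R) : 0 <= X -> 0 <= Y -> X <= U * Y ->
  Num.max 0 (- U * a) <= b -> 0 <= a * X + b * Y.
Proof.
move=> X0 Y0 XUY; rewrite ge_max => /andP[b0 ab].
rewrite -[leLHS](mul0r Y); apply: slope_ge XUY _ _ => //.
by move: ab; rewrite mulNr -subr_ge0 opprK.
Qed.

(** Strictness leaves room: by continuity both conditions on [eps] in [slope_ge] persist near [t0].
    As [U] stays below [M] there, [X + Y <= (1 + M) * Y], which turns a bound in [Y] into one in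
    [X + Y]. *)
Lemma near_slope (a b U : R -> R) (t0 : R) :
  {for t0, continuous a} -> {for t0, continuous b} -> {for t0, continuous U} ->
  Num.max 0 (- U t0 * a t0) < b t0 ->
  exists2 c : R, 0 < c & \forall t \near t0, forall X Y : R,
    0 <= X -> 0 <= Y -> X <= U t * Y -> c * (X + Y) <= a t * X + b t * Y.
Proof.
move=> ca cb cU; rewrite gt_max => /andP[b0 ab].
have cg : {for t0, continuous (fun t => b t + U t * a t)}.
  by apply: continuousD => //; exact: continuousM.
have g0 : 0 < b t0 + U t0 * a t0 by move: ab; rewrite mulNr -subr_gt0 opprK.
pose eps := Num.min (b t0) (b t0 + U t0 * a t0) / 2.
have min0 : 0 < Num.min (b t0) (b t0 + U t0 * a t0) by rewrite lt_min b0.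
have eps0 : 0 < eps by rewrite divr_gt0.
have epsm : eps < Num.min (b t0) (b t0 + U t0 * a t0).
  by rewrite /eps ltr_pdivrMr// ltr_pMr// ltr1n.
have [epsb epsg] : eps < b t0 /\ eps < b t0 + U t0 * a t0.
  by apply/andP; rewrite -lt_min.
pose M := `|U t0| + 1.
have M0 : 0 < 1 + M by rewrite addr_gt0// ltr_wpDl.
exists (eps / (1 + M)); first exact: divr_gt0.
near=> t => X Y X0 Y0 XUY.
have tb : eps < b t by near: t; apply: (cvgr_gt _ cb).
have tg : eps < b t + U t * a t by near: t; apply: (cvgr_gt _ cg).
have tM : U t < M.
  near: t; apply: (cvgr_lt _ cU); rewrite /M.
  by apply: le_lt_trans (ler_norm _) _; rewrite ltrDl.
apply: le_trans (slope_ge X0 Y0 XUY (ltW tb) (ltW tg)).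
rewrite -mulrA ler_pM2l// mulrC ler_pdivrMr// mulrDr mulr1 addrC lerD2l.
by apply: le_trans XUY _; rewrite mulrC ler_wpM2l// ltW.
Unshelve. all: by end_near. Qed.

End Slope.

(** * Behaviour along the curve *)

Section Curve.
Variables (R : realType) (d : nat) (dsp : measure_display).
Variables (Omega : measurableType dsp) (omega : vertex d -> Omega -> bool).
Variable P : R -> R -> probability Omega R.
Hypothesis P_law : forall p q : R, 0 <= p <= 1 -> 0 <= q <= 1 ->
  site_bond_percolation omega (P p q) p q.

Definition decays (f : nat -> R) : Prop :=
  exists2 c : R, 0 < c & exists N : nat, forall n : nat, (N <= n)%N ->
    f n <= expR (- c * n%:R).

Lemma decays_le (f g : nat -> R) : (forall n, f n <= g n) -> decays g -> decays f.
Proof.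
move=> fg [c c0 [N gN]]; exists c => //; exists N => n /gN.
exact: le_trans.
Qed.

Lemma decays_le0 (f : nat -> R) (a : R) : (forall n, a <= f n) -> decays f -> a <= 0.
Proof.
move=> af [c c0 [N fN]]; rewrite leNgt; apply/negP => a0.
(* Then [c * n > 1 / a], and [1 + x <= expR x] puts the exponential bound below [a]. *)
pose n := maxn N (Num.bound (c * a)^-1).
have : a <= expR (- c * n%:R) by apply: le_trans (af n) (fN n _); exact: leq_maxl.
rewrite mulNr expRN -[a]invrK lef_pV2 ?posrE ?expR_gt0 ?invr_gt0// leNgt => /negP; apply.
apply: lt_le_trans (expR_ge1Dx _); apply: (@lt_trans _ _ (c * n%:R)); last by rewrite ltrDr.
rewrite -ltr_pdivrMl// mulrC -invfM mulrC.
have /archi_boundP : 0 <= (c * a)^-1 by rewrite invr_ge0 mulr_ge0// ltW.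
by move=> /lt_le_trans; apply; rewrite ler_nat leq_maxr.
Qed.

Lemma ltW01 (t : R) : 0 < t < 1 -> 0 <= t <= 1.
Proof. by move=> /andP[/ltW -> /ltW ->]. Qed.

Lemma near01 (t : R) : 0 < t < 1 -> \forall u \near t, 0 < u < 1.
Proof.
move=> t01; have : t \in `]0, 1[ by rewrite in_itv.
by move=> /near_in_itvoo; apply: filterS => u; rewrite in_itv.
Qed.

Lemma derive1_theta_n_bond n p q : (0 < n)%N -> 0 < p < 1 -> 0 < q < 1 ->
  derive1 (fun x => theta_n omega P n x q) p = bond_influence d n p q.
Proof.
move=> n0 p01 q01; rewrite derive1E.
have D := @is_derive_ball_prob R d n id (cst q) _ _ p (is_derive_id _ _) (is_derive_cst q p 1) p01 q01.
have : is_derive p 1 (fun x => theta_n omega P n x q) (1 * bond_influence d n p q + 0 * site_influence d n p q).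
  (* The law is prescribed for parameters in the unit interval only, so the two functions are known
     to agree near [p] rather than everywhere. *)
  apply: near_eq_is_derive D; near=> x.
  have x01 : 0 < x < 1 by near: x; exact: near01.
  by rewrite (theta_nE (P_law _ _))//; exact: ltW01.
by move=> [_ ->]; rewrite mul1r mul0r addr0.
Unshelve. all: by end_near. Qed.

Lemma derive1_theta_n_site n p q : (0 < n)%N -> 0 < p < 1 -> 0 < q < 1 ->
  derive1 (fun y => theta_n omega P n p y) q = site_influence d n p q.
Proof.
move=> n0 p01 q01; rewrite derive1E.
have D := @is_derive_ball_prob R d n (cst p) id _ _ q (is_derive_cst p q 1) (is_derive_id _ _) p01 q01.
have : is_derive q 1 (fun y => theta_n omega P n p y) (0 * bond_influence d n p q + 1 * site_influence d n p q).
  apply: near_eq_is_derive D; near=> y.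
  have y01 : 0 < y < 1 by near: y; exact: near01.
  by rewrite (theta_nE (P_law _ _))//; exact: ltW01.
by move=> [_ ->]; rewrite mul1r mul0r add0r.
Unshelve. all: by end_near. Qed.

(* The factor [2] turns [theta_n_step] into a contraction; [unit_ball] accounts
   for the sites that may replace an exit vertex. *)
Definition phi_threshold : R := (2 * #|` unit_ball d|%:R)^-1.

Lemma unit_ball_gt0 : (0 < #|` unit_ball d|)%N.
Proof.
rewrite cardfs_gt0; apply/fset0Pn; exists 0.
by rewrite in_fset_set; [apply/mem_set; rewrite /= linf_norm0|exact: finite_linf_ball].
Qed.

Lemma phi_threshold01 : 0 < phi_threshold <= 1.
Proof.
have K0 := unit_ball_gt0.
rewrite invr_gt0 mulr_gt0 ?ltr0n//= invf_le1 ?mulr_gt0 ?ltr0n//.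
by rewrite -natrM (ler_nat _ 1) muln_gt0.
Qed.

(** The dichotomy: a single [S] with [phi] below the threshold forces decay by [theta_n_decay];
    otherwise [influence_ge] applies. *)
Lemma influence_ge_of_not_decays n p q : 0 < p < 1 -> 0 < q < 1 ->
  ~ decays (fun k => theta_n omega P k p q) ->
  phi_threshold * (1 - q) <= bond_influence d n p q + site_influence d n p q.
Proof.
move=> p01 q01 nd; apply: influence_ge => //.
  by have /andP[/ltW -> ->] := phi_threshold01.
move=> S oS BS; rewrite leNgt; apply/negP => phi_lt; apply: nd.
have [p01' q01'] := (ltW01 p01, ltW01 q01).
apply: (theta_n_decay p01' q01' (P_law p01' q01') oS BS).
move: phi_lt; rewrite /phi_threshold invfM ltr_pdivlMr ?ltr0n ?unit_ball_gt0//.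
by rewrite mulr_natr => /ltW.
Qed.

Variables gp gq : R -> R.
Hypotheses (gp_cont : {within `[0, 1], continuous gp})
  (gq_cont : {within `[0, 1], continuous gq}).
Hypothesis g_range : forall t : R, 0 <= t <= 1 -> 0 <= gp t <= 1 /\ 0 <= gq t <= 1.
Hypothesis gp_der : forall t : R, 0 < t < 1 -> derivable gp t 1.
Hypothesis gq_der : forall t : R, 0 < t < 1 -> derivable gq t 1.
Hypothesis g_int : forall t : R, 0 < t < 1 -> 0 < gp t < 1 /\ 0 < gq t < 1.

Local Notation theta_g n := (fun t => theta_n omega P n (gp t) (gq t)).

Definition curve_slope n t := derive1 gp t * bond_influence d n (gp t) (gq t) +
  derive1 gq t * site_influence d n (gp t) (gq t).

(** Mean value inequality: subtracting [c * t] leaves a function with nonnegative derivative inside,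
    continuous up to the endpoints, where the curve need not be differentiable. *)
Lemma theta_n_curve_incr n (a b c : R) : (0 < n)%N -> 0 <= a -> a <= b -> b <= 1 ->
  (forall t, a < t < b -> c <= curve_slope n t) ->
  c * (b - a) <= theta_g n b - theta_g n a.
Proof.
move=> n0 a0 ab b1 cD.
pose f t := ball_prob d n (gp t) (gq t) - c * t.
have t01 t : a < t < b -> 0 < t < 1.
  by move=> /andP[at_ tb]; rewrite (le_lt_trans a0 at_) (lt_le_trans tb b1).
have Df t : a < t < b -> is_derive t 1 f (curve_slope n t - c).
  move=> tab; have [gp01 gq01] := g_int (t01 _ tab).
  have dp : is_derive t 1 gp (derive1 gp t).
    by rewrite derive1E; exact/derivableP/gp_der/t01.
  have dq : is_derive t 1 gq (derive1 gq t).
    by rewrite derive1E; exact/derivableP/gq_der/t01.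
  have D := is_derive_ball_prob d n dp dq gp01 gq01.
  have Dc : is_derive t 1 (fun u => c * u) c.
    have := @is_deriveZ _ _ _ id c t 1 1 (is_derive_id t 1).
    by rewrite /GRing.scale /= mulr1.
  exact: (is_deriveB D Dc).
have f_cont : {within `[0, 1], continuous f}.
  have c1 : {within `[0, 1], continuous (fun t => ball_prob d n (gp t) (gq t))}.
    exact: within_continuous_ball_prob.
  have c2 : {within `[0, 1], continuous (fun t : R => c * t)}.
    apply: continuous_subspaceT; exact: mulrl_continuous.
  exact: (within_continuousB c1 c2).
have fab : f a <= f b.
  apply: (@ger0_derive1_ndecr _ f a b) => //.
  - by move=> t; rewrite in_itv /= => /Df[].
  - by move=> t; rewrite in_itv /= => tab; rewrite derive1E; have [_ ->] := Df t tab;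
      rewrite subr_ge0; exact: cD.
  - apply/(continuous_subspaceW _ f_cont)/subset_itv; by rewrite bnd_simp.
have thE t : 0 <= t <= 1 -> theta_g n t = ball_prob d n (gp t) (gq t).
  by move=> /g_range[gp01 gq01]; rewrite (theta_nE (P_law _ _)).
rewrite !thE ?a0 ?b1 ?(le_trans a0 ab) ?(le_trans ab b1)//.
by move: fab; rewrite /f mulrBr; lra.
Qed.

Lemma continuous_within_itvoo (f : R -> R) t :
  {within `]0, 1[, continuous f} -> 0 < t < 1 -> {for t, continuous f}.
Proof.
rewrite continuous_open_subspace; last exact: interval_open.
by move=> fc t01; apply: fc; apply/mem_set; rewrite /= in_itv.
Qed.

Lemma continuous_along_curve (u : R * R -> R) t :
  {within `]0, 1[ `*` `]0, 1[, continuous u} -> 0 < t < 1 ->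
  {for t, continuous (fun s => u (gp s, gq s))}.
Proof.
move=> uc t01; have [gp01 gq01] := g_int t01.
have oo : open (`]0, 1[ `*` `]0, 1[ : set (R * R)).
  rewrite openE => -[a b] [/= a01 b01].
  by exists (`]0, 1[%classic, `]0, 1[%classic); rewrite //=; split => /=;
    [exact: near_in_itvoo a01|exact: near_in_itvoo b01].
have uct : {for (gp t, gq t), continuous u}.
  move: uc; rewrite continuous_open_subspace//; apply.
  by apply/mem_set; split; rewrite /= in_itv.
apply: (@continuous_comp _ _ _ (fun s => (gp s, gq s)) u) => //.
have tin : t \in `]0, 1[ by rewrite in_itv.
have cp : gp s @[s --> t] --> gp t by exact: (within_continuous_continuous ltr01 gp_cont tin).
have cq : gq s @[s --> t] --> gq t by exact: (within_continuous_continuous ltr01 gq_cont tin).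
exact: (cvg_pair cp cq).
Qed.

End Curve.

(** * Monotonicity, subcritical decay and linear growth along the curve *)

Theorem theorem2p5 (R : realType) (d : nat) (d_gt0 : (0 < d)%N)
    (dsp : measure_display) (Omega : measurableType dsp)
    (omega : vertex d -> Omega -> bool)
    (P : R -> R -> probability Omega R)
    (P_law : forall p q : R, 0 <= p <= 1 -> 0 <= q <= 1 ->
       site_bond_percolation omega (P p q) p q)
    (u v : R * R -> R)
    (u_cont : {within `]0, 1[ `*` `]0, 1[, continuous u})
    (v_cont : {within `]0, 1[ `*` `]0, 1[, continuous v})
    (u_gt0 : forall p q : R, 0 < p < 1 -> 0 < q < 1 -> 0 < u (p, q))
    (v_gt0 : forall p q : R, 0 < p < 1 -> 0 < q < 1 -> 0 < v (p, q))
    (dp_le : forall (p q : R) (n : nat), 0 < p < 1 -> 0 < q < 1 -> (1 <= n)%N ->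
       derive1 (fun x => theta_n omega P n x q) p <=
       u (p, q) * derive1 (fun y => theta_n omega P n p y) q)
    (dq_le : forall (p q : R) (n : nat), 0 < p < 1 -> 0 < q < 1 -> (1 <= n)%N ->
       derive1 (fun y => theta_n omega P n p y) q <=
       v (p, q) * derive1 (fun x => theta_n omega P n x q) p)
    (gp gq : R -> R)
    (gp_cont : {within `[0, 1], continuous gp})
    (gq_cont : {within `[0, 1], continuous gq})
    (g_range : forall t : R, 0 <= t <= 1 -> 0 <= gp t <= 1 /\ 0 <= gq t <= 1)
    (gp_der : forall t : R, 0 < t < 1 -> derivable gp t 1)
    (gq_der : forall t : R, 0 < t < 1 -> derivable gq t 1)
    (gp_C1 : {within `]0, 1[, continuous (derive1 gp)})
    (gq_C1 : {within `]0, 1[, continuous (derive1 gq)})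
    (g_int : forall t : R, 0 < t < 1 -> 0 < gp t < 1 /\ 0 < gq t < 1)
    (g_slope : forall t : R, 0 < t < 1 ->
       Num.max 0 (- u (gp t, gq t) * derive1 gp t) <= derive1 gq t \/
       Num.max 0 (- v (gp t, gq t) * derive1 gq t) <= derive1 gp t) :
  (forall (n : nat) (s t : R), 0 <= s -> s <= t -> t <= 1 ->
     theta_n omega P n (gp s) (gq s) <= theta_n omega P n (gp t) (gq t)) /\
  (forall tc : R, 0 < tc < 1 ->
     (forall t : R, 0 <= t < tc -> theta omega P (gp t) (gq t) = 0) ->
     (forall t : R, tc < t <= 1 -> 0 < theta omega P (gp t) (gq t)) ->
     Num.max 0 (- u (gp tc, gq tc) * derive1 gp tc) < derive1 gq tc \/
     Num.max 0 (- v (gp tc, gq tc) * derive1 gq tc) < derive1 gp tc ->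
     (forall t : R, 0 <= t < tc ->
        exists2 c : R, 0 < c & exists N : nat, forall n : nat, (N <= n)%N ->
          theta_n omega P n (gp t) (gq t) <= expR (- c * n%:R)) /\
     (exists c delta : R, [/\ 0 < c, 0 < delta, tc + delta <= 1 &
        forall t : R, tc <= t <= tc + delta ->
          c * (t - tc) <= theta omega P (gp t) (gq t)])).
Proof.
pose th n t := theta_n omega P n (gp t) (gq t).
pose X n t := bond_influence d n (gp t) (gq t).
pose Y n t := site_influence d n (gp t) (gq t).
have law t : 0 <= t <= 1 -> site_bond_percolation omega (P (gp t) (gq t)) (gp t) (gq t).
  by move=> /g_range[gp01 gq01]; exact: P_law.
have X0 n t : 0 < t < 1 -> 0 <= X n t.
  by move=> /g_int[gp01 gq01]; exact: bond_influence_ge0.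
have Y0 n t : 0 < t < 1 -> 0 <= Y n t.
  by move=> /g_int[gp01 gq01]; exact: site_influence_ge0.
have XY n t : (0 < n)%N -> 0 < t < 1 -> X n t <= u (gp t, gq t) * Y n t.
  move=> n0 /g_int[gp01 gq01]; have := dp_le _ _ n gp01 gq01 n0.
  by rewrite derive1_theta_n_bond// derive1_theta_n_site.
have YX n t : (0 < n)%N -> 0 < t < 1 -> Y n t <= v (gp t, gq t) * X n t.
  move=> n0 /g_int[gp01 gq01]; have := dq_le _ _ n gp01 gq01 n0.
  by rewrite derive1_theta_n_bond// derive1_theta_n_site.
have incr n a b c : (0 < n)%N -> 0 <= a -> a <= b -> b <= 1 ->
    (forall t, a < t < b -> c <= curve_slope d gp gq n t) -> c * (b - a) <= th n b - th n a.
  exact: theta_n_curve_incr.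
have mono n s t : 0 <= s -> s <= t -> t <= 1 -> th n s <= th n t.
  move=> s0 st t1; case: n => [|n]; first by rewrite /th !theta_n0.
  rewrite -subr_ge0 -[leLHS](mul0r (t - s)); apply: incr => // x /andP[sx xt].
  have x01 : 0 < x < 1 by rewrite (le_lt_trans s0 sx) (lt_le_trans xt t1).
  case: (g_slope _ x01) => slope.
    exact: slope_ge0 (X0 n.+1 x x01) (Y0 n.+1 x x01) (XY n.+1 x isT x01) slope.
  (* The second inequality is the first with bonds and sites exchanged. *)
  rewrite /curve_slope addrC.
  exact: slope_ge0 (Y0 n.+1 x x01) (X0 n.+1 x x01) (YX n.+1 x isT x01) slope.
split=> // tc tc01 sub super strict.
have gp'c : {for tc, continuous (derive1 gp)} by exact: continuous_within_itvoo.
have gq'c : {for tc, continuous (derive1 gq)} by exact: continuous_within_itvoo.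
have uc : {for tc, continuous (fun t => u (gp t, gq t))}.
  exact: continuous_along_curve.
have vc : {for tc, continuous (fun t => v (gp t, gq t))}.
  exact: continuous_along_curve.
have [c c0 near_c] : exists2 c : R, 0 < c & \forall t \near tc, forall n, (0 < n)%N ->
    c * (X n t + Y n t) <= curve_slope d gp gq n t.
  case: strict => strict.
    have [c c0 near_c] := near_slope gp'c gq'c uc strict.
    exists c => //; near=> t => n n0.
    have t01 : 0 < t < 1 by near: t; exact: near01.
    by apply: (near near_c t) => //; [exact: X0|exact: Y0|exact: XY].
  have [c c0 near_c] := near_slope gq'c gp'c vc strict.
  exists c => //; near=> t => n n0.
  have t01 : 0 < t < 1 by near: t; exact: near01.
  rewrite addrC /curve_slope [leRHS]addrC.
  by apply: (near near_c t) => //; [exact: Y0|exact: X0|exact: YX].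
(* Near [tc] the factor [1 - gq t] is at least half its value at [tc]. *)
pose k := phi_threshold R d * ((1 - gq tc) / 2).
have qtc : 0 < 1 - gq tc by rewrite subr_gt0; have [_ /andP[]] := g_int _ tc01.
have /andP[thr0 _] := phi_threshold01 R d.
have k0 : 0 < k by rewrite mulr_gt0// divr_gt0.
have gqc : gq t @[t --> tc] --> gq tc.
  have tin : tc \in `]0, 1[ by rewrite in_itv.
  exact: (within_continuous_continuous ltr01 gq_cont tin).
have : \forall t \near tc, [/\ 0 < t < 1, gq t <= (1 + gq tc) / 2 &
    forall n, (0 < n)%N -> c * (X n t + Y n t) <= curve_slope d gp gq n t].
  near=> t; split; [by near: t; exact: near01| |by near: t].
  by apply: ltW; near: t; apply: (cvgr_lt _ gqc); lra.
move=> /nbhs_ballP[e /= e0 near_e].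
have slope_ge t n : `|tc - t| < e -> (0 < n)%N ->
    ~ decays (fun m => th m t) -> c * k <= curve_slope d gp gq n t.
  move=> te n0 nd; have [t01 gqt sl] := near_e t te.
  apply: le_trans (sl n n0); rewrite ler_pM2l//.
  have [gp01 gq01] := g_int _ t01.
  apply: le_trans (influence_ge_of_not_decays P_law n gp01 gq01 nd).
  by rewrite /k ler_pM2l//; lra.
have th_incr n a b : (0 < n)%N -> 0 <= a -> a <= b -> b <= 1 -> tc - e < a -> b < tc + e ->
    (forall t, a < t < b -> ~ decays (fun m => th m t)) -> c * k * (b - a) <= th n b.
  move=> n0 a0 ab b1 ea be nd.
  have : c * k * (b - a) <= th n b - th n a.
    apply: incr => // t /andP[at_ tb]; apply: slope_ge => //; last by apply: nd; rewrite at_ tb.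
    by rewrite ltr_norml; lra.
  by move=> /le_trans; apply; rewrite gerBl; exact: theta_n_ge0.
have /andP[tc0 tc1] := tc01.
split=> [t /andP[t0 ttc]|].
(* Without decay at [t] there is none between [t] and [tc], by monotonicity. The uniform slope then
   makes [theta] positive at some [b < tc], against [sub]. *)
- apply: contrapT => nd.
  (* [a] is at least [t] and lies in the window around [tc] where the slope is controlled. *)
  pose a := Num.max t (tc - e / 2); pose b := (a + tc) / 2.
  have ta : t <= a by rewrite le_max lexx.
  have ea : tc - e / 2 <= a by rewrite le_max lexx orbT.
  have atc : a < tc by rewrite gt_max ttc /=; lra.
  have ab : a < b by rewrite /b; lra.
  have btc : b < tc by rewrite /b; lra.
  have a0 : 0 <= a by exact: le_trans ta.
  have b1 : b <= 1 by rewrite ltW// (lt_trans btc).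
  have b0 : 0 <= b by exact: le_trans a0 (ltW ab).
  have b01 : 0 <= b <= 1 by rewrite b0.
  have thb n : (0 < n)%N -> c * k * (b - a) <= th n b.
    move=> n0; apply: th_incr => //; [exact: ltW|lra|lra|].
    move=> s /andP[as_ sb] ds; apply: nd; apply: decays_le ds => m.
    by apply: mono => //; [exact: le_trans ta (ltW as_)|exact: le_trans (ltW sb) b1].
  (* [theta_n] is [1] at radius [0], so the bound at radius [1] implies this case. *)
  have {}thb n : c * k * (b - a) <= th n b.
    case: n => [|n]; last exact: thb.
    by apply: le_trans (thb 1%N isT) _; rewrite /th theta_n0; exact: theta_n_le1 (law b b01) 1%N.
  have : c * k * (b - a) <= theta omega P (gp b) (gq b).
    exact: theta_ge (law b b01) _ thb.
  rewrite sub ?b0//.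
  by rewrite leNgt mulr_gt0// ?subr_gt0// mulr_gt0.
(* [e / 2] keeps the interval inside the window, [1 - tc] inside the domain of the curve. *)
- exists (c * k), (Num.min (e / 2) (1 - tc)); split; first exact: mulr_gt0.
  + by rewrite lt_min; lra.
  + have : Num.min (e / 2) (1 - tc) <= 1 - tc by rewrite ge_min lexx orbT.
    by lra.
  + have m1 : Num.min (e / 2) (1 - tc) <= 1 - tc by rewrite ge_min lexx orbT.
    have m2 : Num.min (e / 2) (1 - tc) <= e / 2 by rewrite ge_min lexx.
    move=> t /andP[tct tm]; have t01 : 0 <= t <= 1 by lra.
    apply: (theta_ge (law t t01)) => n.
    have thn m : (0 < m)%N -> c * k * (t - tc) <= th m t.
      move=> m0; apply: th_incr => //; [lra..|].
      move=> s /andP[tcs st] ds.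
      have s01 : 0 <= s <= 1 by lra.
      (* Decay at [s] would make [theta] vanish there, but it is positive beyond [tc]. *)
      have : theta omega P (gp s) (gq s) <= 0.
        apply: decays_le0 ds => j; exact: theta_le_theta_n (law s s01) j.
      by rewrite leNgt super//; lra.
    case: n => [|n]; last exact: thn.
    apply: le_trans (thn 1%N _) _ => //; rewrite theta_n0; exact: theta_n_le1 (law t t01) 1%N.
Unshelve. all: by end_near. Qed.
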